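(* Let $\{\varepsilon_{k}\}_{k=1}^{\infty}$ be a decreasing sequence of positive numbers tending to $0$ such that $\varepsilon_{k+1}<\frac{1}{2}\varepsilon_{k}$ for all $k\in\mathbb{N}$. Then there exist increasing sequences $\{r_{k}\}_{k=1}^{\infty}$, $\{m_{k}\}_{k=1}^{\infty}$, $\{n_{k}\}_{k=1}^{\infty}$ of positive integers satisfying $$r_{k}>2\sum_{j=1}^{k-1}\big((2^{n_{j}}-1)m_{j}+r_{j}\big)\quad\text{for }k\geq 2,$$ $$m_{k}>2\sum_{j=1}^{k-1}\big((2^{n_{j}}-1)m_{j}+r_{j}\big)\quad\text{for }k\geq 2,$$ $$\tfrac{1}{2}<\varepsilon_{k}2^{\frac{n_{k}+3}{2}}<1,$$ such that, with $w_k$ the polynomials associated to these sequences, the measure $$\mu=\prod_{k=1}^{\infty}(1-w_{k})$$ is a positive measure in $M_{0}(\mathbb{T})$ of norm $1$, is singular with respect to Lebesgue measure, and satisfies $$\widehat{\mu}(\mathbb{Z})\subset\Big\{\pm\prod_{k=1}^{m}\varepsilon_{k}^{l_{k}}:\ l_{k}\in\{0,1\},\ m\in\mathbb{N}\Big\}\cup\{0\}.$$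
   Context: $M(\mathbb{T})$ is the space of complex Borel measures on the circle group $\mathbb{T}$ with the total variation norm, $\widehat{\mu}(n)=\int e^{-int}\,d\mu(t)$, $\widehat{\mu}(\mathbb{Z})=\{\widehat{\mu}(n):n\in\mathbb{Z}\}$, and $M_0(\mathbb{T})$ is the set of $\mu\in M(\mathbb{T})$ with $\widehat{\mu}(n)\to0$ as $|n|\to\infty$. Functions on $\mathbb{T}$ are identified with absolutely continuous measures via the normalized Lebesgue measure. Rudin--Shapiro polynomials: $P_0\equiv 1$, $Q_0\equiv 1$, and $P_{n+1}(t)=P_n(t)+e^{i2^nt}Q_n(t)$, $Q_{n+1}(t)=P_n(t)-e^{i2^nt}Q_n(t)$. Given increasing sequences of positive integers $\{r_k\},\{m_k\},\{n_k\}$ and a decreasing sequence of positive numbers $\varepsilon_k\to0$, the associated polynomials are $$w_k(t)=\varepsilon_kP_{n_k}(m_kt)e^{ir_kt}+\varepsilon_k\overline{P_{n_k}(m_kt)}e^{-ir_kt}.$$ The notation $\mu=\prod_{k=1}^\infty(1-w_k)$ means that $\mu$ is the limit in the weak-star topology of $M(\mathbb{T})$ of the polynomials $f_N(t)=\prod_{k=1}^N(1-w_k(t))$ as $N\to\infty$.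
   Formalization: The formal theorem adds the assumption ε_1 < 1/4, which is forced by n_1 ≥ 1 and ε_1·2^{(n_1+3)/2} < 1; without it the claim fails, e.g. for ε_k = 3^{-k}. *)

(* Defs.v *)
From HB Require Import structures.
From mathcomp Require Import all_boot all_order all_algebra.
From mathcomp Require Import all_classical all_reals all_analysis.
From mathcomp Require Import complex.

Set Implicit Arguments.
Unset Strict Implicit.
Unset Printing Implicit Defensive.

Import Order.TTheory GRing.Theory Num.Theory.
Import numFieldNormedType.Exports.

Local Open Scope classical_set_scope.
Local Open Scope ring_scope.
Local Open Scope complex_scope.

(* Integral of a real function against a signed measure, through its Jordan
   decomposition. The result does not depend on the Hahn decomposition picked
   here. *)
Section charge_integral.
Context d (T : measurableType d) (R : realType).
Variable nu : {charge set T -> \bar R}.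

Definition hahn_pos : set T := projT1 (cid (Hahn_decomposition nu)).

Definition hahn_neg : set T :=
  projT1 (cid (projT2 (cid (Hahn_decomposition nu)))).

Definition hahnP : hahn_decomposition nu hahn_pos hahn_neg :=
  projT2 (cid (projT2 (cid (Hahn_decomposition nu)))).

Definition charge_integral (D : set T) (f : T -> R) : R :=
  \int[jordan_pos hahnP]_(x in D) f x - \int[jordan_neg hahnP]_(x in D) f x.

End charge_integral.

Section circle.
Context (R : realType).

(* The circle group R / 2 pi Z is represented by its fundamental domain
   [0, 2 pi[, which is Borel isomorphic to it. Functions on the circle are
   2 pi-periodic functions on R, so that continuity on R is continuity on the
   circle (at 0 as well). *)
Definition circle : set (measurableTypeR R) := `[0, 2 * pi[.

(* Complex measures nu1 + i nu2 with nu1, nu2 finite signed Borel measures. *)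
Record circle_measure := CircleMeasure {
  cm_re : {charge set (measurableTypeR R) -> \bar R} ;
  cm_im : {charge set (measurableTypeR R) -> \bar R} ;
  cm_carried : forall A, measurable A -> A `&` circle = set0 ->
    cm_re A = 0%E /\ cm_im A = 0%E }.

Definition cm_val (mu : circle_measure) (A : set (measurableTypeR R)) : R[i] :=
  fine (cm_re mu A) +i* fine (cm_im mu A).

Definition cm_integral (mu : circle_measure) (f : R -> R[i]) : R[i] :=
  let re t := complex.Re (f t) in
  let im t := complex.Im (f t) in
  (charge_integral (cm_re mu) circle re - charge_integral (cm_im mu) circle im)
  +i*
  (charge_integral (cm_re mu) circle im + charge_integral (cm_im mu) circle re).

Definition cm_norm (mu : circle_measure) : \bar R :=
  ereal_sup [set s | exists E : nat -> set (measurableTypeR R),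
    [/\ forall i, measurable (E i), trivIset setT E, \bigcup_i E i = circle &
        s = (\sum_(0 <= i <oo) (complex.Re `|cm_val mu (E i)|)%:E)%E]].

(* The order of R[i] makes [0 <= z] mean that z is real and nonnegative. *)
Definition cm_positive (mu : circle_measure) : Prop :=
  forall A, measurable A -> 0 <= cm_val mu A.

Definition cm_singular (mu : circle_measure) : Prop :=
  exists A : set (measurableTypeR R),
    [/\ measurable A, A `<=` circle, @lebesgue_measure R A = 0%E &
        forall B, measurable B -> B `&` A = set0 -> cm_val mu B = 0].

Definition cis (t : R) : R[i] := cos t +i* sin t.

Definition fourier (mu : circle_measure) (n : int) : R[i] :=
  cm_integral mu (fun t => cis (- (n%:~R * t))).

Definition M0 (mu : circle_measure) : Prop :=
  forall e : R, 0 < e -> exists N : nat, forall n : int,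
    (N <= `|n|)%N -> `|fourier mu n| < e%:C.

Definition continuous_on_circle (g : R -> R[i]) : Prop :=
  continuous (g : R -> R[i]^o) /\ forall t, g (t + 2 * pi) = g t.

Definition haar_integral (f : R -> R[i]) : R[i] :=
  ((2 * pi)^-1)%:C *
  ((\int[@lebesgue_measure R]_(t in circle) complex.Re (f t)) +i*
   (\int[@lebesgue_measure R]_(t in circle) complex.Im (f t))).

(* Weak-star convergence, as functionals on continuous functions, of the
   absolutely continuous measures f_N dt / (2 pi) to mu. *)
Definition weak_star_limit (f : nat -> R -> R[i]) (mu : circle_measure) : Prop :=
  forall g, continuous_on_circle g ->
    (fun N => haar_integral (fun t => g t * f N t) : R[i]^o) @ \oo -->
    (cm_integral mu g : R[i]^o).

Fixpoint rudin_shapiro (n : nat) (t : R) : R[i] * R[i] :=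
  if n is n'.+1 then
    let: (p, q) := rudin_shapiro n' t in
    (p + cis ((2 ^ n')%:R * t) * q, p - cis ((2 ^ n')%:R * t) * q)
  else (1, 1).

Definition RS_P (n : nat) (t : R) : R[i] := (rudin_shapiro n t).1.

(* Sequences are indexed from 0 here, the index k standing for k + 1 in
   products over k >= 1. *)
Section riesz.
Variables (eps : nat -> R) (r m n : nat -> nat).

Definition riesz_w (k : nat) (t : R) : R[i] :=
  (eps k)%:C * RS_P (n k) ((m k)%:R * t) * cis ((r k)%:R * t) +
  (eps k)%:C * (RS_P (n k) ((m k)%:R * t))^* * cis (- ((r k)%:R * t)).

Definition riesz_partial (N : nat) (t : R) : R[i] :=
  \prod_(k < N) (1 - riesz_w k t).

Definition freq_bound (k : nat) : nat :=
  \sum_(j < k) ((2 ^ n j - 1) * m j + r j).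

Definition signed_products : set R[i] :=
  [set z | exists (s : bool) (p : nat) (l : nat -> bool),
    (0 < p)%N /\ z = (-1) ^+ s * (\prod_(k < p) eps k ^+ l k)%:C].

End riesz.
End circle.

(* Main.v *)
From HB Require Import structures.
Require Import Defs.
From mathcomp Require Import all_boot all_order all_algebra.
From mathcomp Require Import all_classical all_reals all_analysis.
From mathcomp Require Import complex measurable_realfun zify ring lra.
Import Order.TTheory GRing.Theory Num.Theory.
Import numFieldNormedType.Exports.
Local Open Scope classical_set_scope.
Local Open Scope ring_scope.

(** The partial products f_N of 1 - w_k are nonnegative, because |P_n|^2 is at
    most 2^(n+1) (parallelogram law) and so |w_k| < 1. All the arithmetic comes
    from the sparseness of the frequencies. The nonzero frequencies of w_k, and
    the differences of two distinct frequencies of 1 - w_k, exceed 2 F_k, where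
    F_k bounds the frequencies of f_k. Hence a frequency of f_N arises from a
    single choice of one term in each factor ([uniq_partial_terms]), and its
    coefficient is a signed product of some of the eps_k. A later factor creates
    only frequencies beyond F_k, with coefficients at most eps_k
    ([partial_terms_decay]), so the coefficients stabilize and tend to 0. The
    other use of the sparseness is the rule M(f g) = M(f) M(g) for the mean M
    over the circle, when the nonzero frequencies of g exceed those of f
    ([haarM]).

    The limit measure is built without weak-star compactness. With n_k fixed by
    eps_k, the frequencies r_k can be taken so large that the primitives of f_N
    change by at most 2^-N at step N: integrating e^(iqt) divides by q, and the
    number of new terms does not depend on r_k ([expprim_step]). The primitives
    of f_N / 2 pi thus converge uniformly to a nondecreasing continuous function,
    and mu is its Lebesgue--Stieltjes measure on [0, 2 pi[ ([limit_measure]).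
    Weak-star convergence follows by comparing both integrals with Riemann sums
    ([weak_limit_of_primitives]). The choice m_k = r_k is enough.

    For singularity, let c_k = M(w_k^2), which is at least 1/16 by the lower
    bound on eps_k 2^((n_k+3)/2). The multiplicativity of M gives
    int w_j w_k dt = 0, int w_k dmu = - c_k and int w_j w_k dmu = c_j c_k for
    j < k. The w_k are thus orthogonal and centred for Lebesgue measure, while
    the w_k + c_k are orthogonal for mu. By Chebyshev's inequality the averages
    of the first 2^i functions w_k tend to 0 almost everywhere for Lebesgue
    measure, but stay near averages of - c_k, hence away from 0, for mu
    ([separating_set]). *)

Set Implicit Arguments.
Unset Strict Implicit.
Unset Printing Implicit Defensive.

Local Open Scope complex_scope.

(** * Exponential sums with real coefficients *)

Section ExponentialSums.
Context (R : realType).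
Implicit Types (s u : seq (R * int)) (t : R).

(** A list of pairs (coefficient, frequency), rather than a function on the
    integers, keeps track of the terms of a product before like frequencies
    are collected; this is what makes the uniqueness of representations a
    statement about lists. *)
Definition expsum s t : R[i] := \sum_(x <- s) x.1%:C * cis (x.2%:~R * t).

Definition expcoef s (n : int) : R := \sum_(x <- s | x.2 == n) x.1.

Definition expmul s u : seq (R * int) :=
  [seq (x.1 * y.1, x.2 + y.2) | x <- s, y <- u].

Lemma cisD (a b : R) : cis (a + b) = cis a * cis b.
Proof.
by rewrite /cis; simpc; rewrite cosD sinD [sin a * cos b + _]addrC.
Qed.

Lemma cis0 : cis (0 : R) = 1.
Proof. by rewrite /cis cos0 sin0. Qed.

Lemma conj_cis (a : R) : (cis a)^*%C = cis (- a).
Proof. by rewrite /cis cosN sinN. Qed.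

Lemma cisM_conj (a : R) : cis a * (cis a)^*%C = 1.
Proof. by rewrite conj_cis -cisD subrr cis0. Qed.

Lemma Re_sum (I : Type) (l : seq I) (F : I -> R[i]) :
  complex.Re (\sum_(i <- l) F i) = \sum_(i <- l) complex.Re (F i).
Proof.
elim: l => [|i l IH]; first by rewrite !big_nil.
by rewrite !big_cons -IH; case: (F i); case: (\sum_(j <- l) _).
Qed.

Lemma Im_sum (I : Type) (l : seq I) (F : I -> R[i]) :
  complex.Im (\sum_(i <- l) F i) = \sum_(i <- l) complex.Im (F i).
Proof.
elim: l => [|i l IH]; first by rewrite !big_nil.
by rewrite !big_cons -IH; case: (F i); case: (\sum_(j <- l) _).
Qed.

Lemma expsum_nil t : expsum [::] t = 0.
Proof. by rewrite /expsum big_nil. Qed.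

Lemma expsum_cons x s t :
  expsum (x :: s) t = x.1%:C * cis (x.2%:~R * t) + expsum s t.
Proof. by rewrite /expsum big_cons. Qed.

Lemma expsum_cat s u t : expsum (s ++ u) t = expsum s t + expsum u t.
Proof. by rewrite /expsum big_cat. Qed.

Lemma Re_expsum s t :
  complex.Re (expsum s t) = \sum_(x <- s) x.1 * cos (x.2%:~R * t).
Proof.
by rewrite Re_sum; apply: eq_bigr => x _ /=; rewrite mul0r subr0.
Qed.

Lemma Im_expsum s t :
  complex.Im (expsum s t) = \sum_(x <- s) x.1 * sin (x.2%:~R * t).
Proof.
by rewrite Im_sum; apply: eq_bigr => x _ /=; rewrite mul0r addr0.
Qed.

Lemma expsum_mul s u t : expsum (expmul s u) t = expsum s t * expsum u t.
Proof.
rewrite /expsum /expmul big_allpairs_dep /= mulr_suml; apply: eq_bigr => x _.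
rewrite mulr_sumr; apply: eq_bigr => y _ /=.
by rewrite intrD mulrDl cisD rmorphM mulrACA.
Qed.

Lemma mem_expmul s u z : z \in expmul s u ->
  exists x y, [/\ x \in s, y \in u & z = (x.1 * y.1, x.2 + y.2)].
Proof. by case/allpairsP => -[x y] [? ? ->]; exists x, y. Qed.

Lemma expcoef_mul s u n :
  expcoef (expmul s u) n =
  \sum_(x <- s) \sum_(y <- u | x.2 + y.2 == n) x.1 * y.1.
Proof.
rewrite /expcoef big_mkcond big_allpairs_dep /=; apply: eq_bigr => x _.
by rewrite [RHS]big_mkcond.
Qed.

Lemma expcoef_mem s n : uniq (map snd s) -> expcoef s n != 0 ->
  exists2 x, x \in s & x.2 = n /\ expcoef s n = x.1.
Proof.
elim: s => [|x s IH] /=; first by rewrite /expcoef big_nil eqxx.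
case/andP=> xs us; rewrite /expcoef big_cons; case: (x.2 =P n) => [xn _|xn].
  exists x; first by rewrite mem_head.
  split => //; rewrite big1_seq ?addr0// => y /andP[/eqP yn ys].
  by case/negP: xs; rewrite xn -yn map_f.
by case/(IH us) => y ys yn; exists y => //; rewrite inE ys orbT.
Qed.

Lemma expcoef_uniq s x : uniq (map snd s) -> x \in s -> expcoef s x.2 = x.1.
Proof.
elim: s => [//|y s IH] /= /andP[ys us]; rewrite inE /expcoef big_cons.
case/predU1P => [->|xs].
  rewrite eqxx big1_seq ?addr0// => z /andP[/eqP zy zs].
  by case/negP: ys; rewrite -zy map_f.
case: (y.2 =P x.2) => [yx|_]; last exact: IH.
by case/negP: ys; rewrite yx map_f.
Qed.

Lemma expcoef0_out s n : (forall x, x \in s -> x.2 != n) -> expcoef s n = 0.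
Proof.
move=> sn; rewrite /expcoef big1_seq// => x /andP[/eqP xn /sn].
by rewrite xn eqxx.
Qed.

(** The primitive of the real part, so that its growth can be read off the
    frequencies. *)
Definition expprim s t : R :=
  \sum_(x <- s) x.1 * (if x.2 == 0 then t else sin (x.2%:~R * t) / x.2%:~R).

Definition expprim_im s t : R :=
  \sum_(x <- s) x.1 * (if x.2 == 0 then 0 else - cos (x.2%:~R * t) / x.2%:~R).

Lemma is_derive_expprim s t : is_derive t 1 (expprim s) (complex.Re (expsum s t)).
Proof.
rewrite Re_expsum; elim: s => [|x s IH].
  rewrite big_nil (_ : expprim _ = cst 0); first exact: is_derive_cst.
  by apply/funext => v; rewrite /expprim big_nil.
rewrite big_cons.
have -> : expprim (x :: s) = (fun v => x.1 *
   (if x.2 == 0 then v else sin (x.2%:~R * v) / x.2%:~R)) \+ expprim s.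
  by apply/funext => v; rewrite /expprim big_cons.
apply: is_deriveD; case: eqP => [->|/eqP x0].
  rewrite mul0r cos0; apply: is_derive_eq.
  by rewrite /GRing.scale.
apply: is_derive_eq.
rewrite /GRing.scale /= mulr0 add0r mulr1; congr (x.1 * _).
by rewrite mulrC mulfK// intr_eq0.
Qed.

Lemma is_derive_expprim_im s t :
  is_derive t 1 (expprim_im s) (complex.Im (expsum s t)).
Proof.
rewrite Im_expsum; elim: s => [|x s IH].
  rewrite big_nil (_ : expprim_im _ = cst 0); first exact: is_derive_cst.
  by apply/funext => v; rewrite /expprim_im big_nil.
rewrite big_cons.
have -> : expprim_im (x :: s) = (fun v => x.1 *
   (if x.2 == 0 then 0 else - cos (x.2%:~R * v) / x.2%:~R)) \+ expprim_im s.
  by apply/funext => v; rewrite /expprim_im big_cons.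
apply: is_deriveD; case: eqP => [->|/eqP x0].
  rewrite mul0r sin0; apply: is_derive_eq.
  by rewrite /GRing.scale /= !mulr0.
apply: is_derive_eq.
rewrite /GRing.scale /= mulr0 add0r mulr1; congr (x.1 * _).
by rewrite mulNr opprK mulrC mulfK// intr_eq0.
Qed.

Lemma continuous_Re_expsum s : continuous (fun t => complex.Re (expsum s t)).
Proof.
rewrite (_ : (fun t => _) = (fun t => \sum_(x <- s) x.1 * cos (x.2%:~R * t))); last first.
  by apply/funext => v; exact: Re_expsum.
elim: s => [|x s IH] t.
  rewrite (_ : (fun t => _) = cst 0); first exact: cvg_cst.
  by apply/funext => v; rewrite big_nil.
rewrite (_ : (fun t => _) = (fun v => x.1 * cos (x.2%:~R * v)) \+
   (fun t => \sum_(x <- s) x.1 * cos (x.2%:~R * t))); last first.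
  by apply/funext => v; rewrite big_cons.
apply: continuousD; last exact: IH.
apply: continuousM; first exact: cvg_cst.
apply: continuous_comp; last exact: continuous_cos.
by apply: continuousM; [exact: cvg_cst|exact: cvg_id].
Qed.

Lemma continuous_Im_expsum s : continuous (fun t => complex.Im (expsum s t)).
Proof.
rewrite (_ : (fun t => _) = (fun t => \sum_(x <- s) x.1 * sin (x.2%:~R * t))); last first.
  by apply/funext => v; exact: Im_expsum.
elim: s => [|x s IH] t.
  rewrite (_ : (fun t => _) = cst 0); first exact: cvg_cst.
  by apply/funext => v; rewrite big_nil.
rewrite (_ : (fun t => _) = (fun v => x.1 * sin (x.2%:~R * v)) \+
   (fun t => \sum_(x <- s) x.1 * sin (x.2%:~R * t))); last first.
  by apply/funext => v; rewrite big_cons.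
apply: continuousD; last exact: IH.
apply: continuousM; first exact: cvg_cst.
apply: continuous_comp; last exact: continuous_sin.
by apply: continuousM; [exact: cvg_cst|exact: cvg_id].
Qed.

(** The half-open interval is the shape of the arcs into which the
    fundamental domain [0, 2 pi[ is cut. *)
Lemma Rintegral_primitive (F f : R -> R) (a b : R) : a <= b ->
  (forall x : R, is_derive x (1 : R) F (f x)) -> continuous f ->
  \int[@lebesgue_measure R]_(x in `[a, b[) f x = F b - F a.
Proof.
rewrite le_eqVlt => /predU1P[->|ab] dF cf.
  by rewrite set_itvco0 Rintegral_set0 subrr.
have cF : continuous F.
  move=> x; apply: differentiable_continuous; apply/derivable1_diffP.
  by case: (dF x).
have cfw : {within `[a, b], continuous f} by exact: continuous_subspaceT.
have ic : (@lebesgue_measure R).-integrable `[a, b] (EFin \o f).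
  by apply: continuous_compact_integrable => //; exact: segment_compact.
rewrite Rintegral_itv_bndo_bndc; last first.
  by apply: integrableS ic => //; exact: subset_itv_co_cc.
rewrite /Rintegral (continuous_FTC2 ab cfw (F := F))//.
  split; first by move=> x _; case: (dF x).
  - by apply: cvg_at_right_filter; exact: cF.
  - by apply: cvg_at_left_filter; exact: cF.
by move=> x _; rewrite derive1E; apply: derive_val.
Qed.

Lemma cis_int2pi (n : int) : cis (n%:~R * (2 * pi)) = 1 :> R[i].
Proof.
have nat1 (k : nat) : cis (k%:R * (2 * pi)) = 1 :> R[i].
  elim: k => [|k IH]; first by rewrite mul0r cis0.
  rewrite -natr1 mulrDl mul1r cisD IH mul1r /cis.
  by rewrite mulr_natl cos2pi sin2pi.
case: n => k; first exact: nat1.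
by rewrite NegzE mulrNz mulNr -conj_cis nat1 conjc1.
Qed.

Lemma twopi_gt0 : 0 < 2 * pi :> R.
Proof. by rewrite mulr_gt0// pi_gt0. Qed.

(** The sines and cosines of nonzero frequency have periodic primitives, so
    only frequency 0 contributes to the increment of the primitive over a
    period. *)
Lemma haar_expsum s : haar_integral (expsum s) = (expcoef s 0)%:C.
Proof.
rewrite /haar_integral /circle.
rewrite (Rintegral_primitive (ltW twopi_gt0) (is_derive_expprim s)
  (@continuous_Re_expsum s)).
rewrite (Rintegral_primitive (ltW twopi_gt0) (is_derive_expprim_im s)
  (@continuous_Im_expsum s)).
have cos2 n : cos (n%:~R * (2 * pi)) = 1 :> R by case: (cis_int2pi n).
have sin2 n : sin (n%:~R * (2 * pi)) = 0 :> R by case: (cis_int2pi n).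
have -> : expprim_im s (2 * pi) = expprim_im s 0.
  by apply: eq_bigr => x _; rewrite cos2 mulr0 cos0.
have -> : expprim s 0 = 0.
  by apply: big1 => x _; rewrite mulr0 sin0 mul0r if_same mulr0.
have -> : expprim s (2 * pi) = expcoef s 0 * (2 * pi).
  rewrite /expprim /expcoef mulr_suml [RHS]big_mkcond /=; apply: eq_bigr => x _.
  by case: ifP => // _; rewrite sin2 mul0r mulr0.
rewrite subrr subr0 -[_ +i* 0]/((_)%:C) -rmorphM; congr (_%:C).
by rewrite mulrCA mulVf ?mulr1// gt_eqF// twopi_gt0.
Qed.

End ExponentialSums.

(** * Rudin--Shapiro polynomials *)

Section RudinShapiro.
Context (R : realType).

(** The two halves of P_(n+1) and Q_(n+1) occupy disjoint blocks of 2^n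
    frequencies, so coefficients are never added. *)
Lemma rudin_shapiro_signs (n : nat) : exists a b : nat -> bool, forall t : R,
  rudin_shapiro n t =
    (\sum_(j <- iota 0 (2 ^ n)) (-1) ^+ a j * cis (j%:R * t),
     \sum_(j <- iota 0 (2 ^ n)) (-1) ^+ b j * cis (j%:R * t)).
Proof.
elim: n => [|n [a [b IH]]].
  exists (fun=> false), (fun=> false) => t.
  by rewrite /= !big_seq1 expr0 mul0r cis0 mulr1.
exists (fun j => if (j < 2 ^ n)%N then a j else b (j - 2 ^ n)%N).
exists (fun j => if (j < 2 ^ n)%N then a j else ~~ b (j - 2 ^ n)%N) => t.
have split_iota : iota 0 (2 ^ n.+1) =
    iota 0 (2 ^ n) ++ [seq (2 ^ n + j)%N | j <- iota 0 (2 ^ n)].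
  by rewrite -iotaDl addn0 expnS mul2n -addnn iotaD.
rewrite split_iota /= IH !big_cat !big_map /=.
have low c : \sum_(j <- iota 0 (2 ^ n))
      (-1) ^+ (if (j < 2 ^ n)%N then a j else c j) * cis (j%:R * t) =
    \sum_(j <- iota 0 (2 ^ n)) (-1) ^+ a j * cis (j%:R * t) :> R[i].
  by apply: eq_big_seq => j; rewrite mem_iota /= add0n => ->.
have high c : \sum_(j <- iota 0 (2 ^ n)) (-1) ^+ (if (2 ^ n + j < 2 ^ n)%N
      then a (2 ^ n + j)%N else c (2 ^ n + j - 2 ^ n)%N) * cis ((2 ^ n + j)%:R * t) =
    cis ((2 ^ n)%:R * t) *
      \sum_(j <- iota 0 (2 ^ n)) (-1) ^+ c j * cis (j%:R * t) :> R[i].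
  rewrite mulr_sumr; apply: eq_bigr => j _.
  by rewrite ltnNge leq_addr /= addKn natrD mulrDl cisD mulrCA.
rewrite !low high (high (fun j => ~~ b j)); congr (_, _ + _).
rewrite -mulrN -sumrN; congr (_ * _); apply: eq_bigr => j _.
by rewrite -mulNr; case: (b j); rewrite /= ?opprK.
Qed.

(** Each step maps (P, Q) to (P + u Q, P - u Q) with |u| = 1, and the
    parallelogram law doubles the sum of squares. *)
Lemma rudin_shapiro_norm (n : nat) (t : R) :
  `|(rudin_shapiro n t).1| ^+ 2 + `|(rudin_shapiro n t).2| ^+ 2 = 2 ^+ n.+1.
Proof.
elim: n => [|n]; first by rewrite /= normr1 expr1n.
rewrite /=; case: (rudin_shapiro n t) => p q /= IH.
have := cisM_conj ((2 ^ n)%:R * t); move: (cis _) => u uu.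
rewrite [RHS]exprS -IH !sqr_normc !rmorphD !rmorphN !rmorphM /=.
have -> : p * p^* + q * q^* = p * p^* + (u * u^*) * (q * q^*) by rewrite uu mul1r.
ring.
Qed.

Lemma RS_P_norm (n : nat) (t : R) : `|RS_P n t| ^+ 2 <= 2 ^+ n.+1.
Proof. by rewrite -(rudin_shapiro_norm n t) lerDl exprn_ge0. Qed.

End RudinShapiro.

(** * Separated spectra are orthogonal *)

Section Spectrum.
Context (R : realType).
Implicit Types (f g : R -> R[i]) (P Q : pred int).

(** Only the existence of a representation matters here, so a function may
    have several lists. *)
Definition spectrum_in P f :=
  exists2 s : seq (R * int), all (fun x => P x.2) s & forall t, f t = expsum s t.

Lemma spectrum_inS P Q f : subpred P Q -> spectrum_in P f -> spectrum_in Q f.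
Proof.
by move=> PQ [s sP fs]; exists s => //; apply: sub_all sP => x; exact: PQ.
Qed.

Lemma spectrum_inM P Q (T : pred int) f g : (forall m n : int, P m -> Q n -> T (m + n)) ->
  spectrum_in P f -> spectrum_in Q g -> spectrum_in T (fun t => f t * g t).
Proof.
move=> PQT [s /allP sP fs] [u /allP uQ gu]; exists (expmul s u).
  by apply/allP => z /mem_expmul[x [y [/sP xP /uQ yQ ->]]]; exact: PQT.
by move=> t; rewrite expsum_mul fs gu.
Qed.

Definition band (D : nat) : pred int := [pred n | `|n| <= D]%N.
Definition gap (D : nat) : pred int := [pred n | (n == 0) || (D < `|n|)%N].

Lemma spectrum_in_bandM a b f g : spectrum_in (band a) f ->
  spectrum_in (band b) g -> spectrum_in (band (a + b)) (fun t => f t * g t).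
Proof. by apply: spectrum_inM => m n; rewrite /band /=; lia. Qed.

Lemma haar_ext f g : f =1 g -> haar_integral f = haar_integral g.
Proof. by move=> fg; congr haar_integral; apply/funext. Qed.

Lemma haar0 P f : spectrum_in P f -> ~~ P 0 -> haar_integral f = 0.
Proof.
case=> s /allP sP /haar_ext -> P0; rewrite haar_expsum expcoef0_out//.
by move=> x /sP; apply: contraTN => /eqP ->.
Qed.

(** A frequency of f cancels a nonzero frequency of g in no term of the
    product, since it is too small. *)
Lemma haarM D f g : spectrum_in (band D) f -> spectrum_in (gap D) g ->
  haar_integral (fun t => f t * g t) = haar_integral f * haar_integral g.
Proof.
case=> s /allP sD fs [u /allP uD gu].
rewrite (@haar_ext _ (expsum (expmul s u))); last first.
  by move=> t; rewrite expsum_mul fs gu.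
rewrite (haar_ext fs) (haar_ext gu) !haar_expsum -rmorphM; congr (_%:C).
rewrite expcoef_mul /expcoef big_distrl /= [RHS]big_mkcond /=.
apply: eq_big_seq => x /sD xD.
case: eqP => x0.
  by rewrite mulr_sumr x0; apply: eq_bigl => y; rewrite add0r.
rewrite big1_seq// => y /andP[xy /uD]; move: xD xy; rewrite /band /gap /=.
by lia.
Qed.

End Spectrum.

(** * Measures on the circle *)

Section ChargeIntegral.
Context d (T : measurableType d) (R : realType).

(** On a positive measure every negative set is null, so whatever Hahn
    decomposition was picked, the negative part vanishes and the positive
    part is the measure itself. *)
Lemma charge_integral_finite_measure (mu : {finite_measure set T -> \bar R})
    (D : set T) (f : T -> R) :
  charge_integral (charge_of_finite_measure mu) D f = \int[mu]_(x in D) f x.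
Proof.
rewrite /charge_integral; set nu := charge_of_finite_measure mu.
have [posP negN PN PN0] := hahnP nu.
have mP : measurable (hahn_pos nu) by case: posP.
have mN : measurable (hahn_neg nu) by case: negN.
have muN0 A : measurable A -> mu (A `&` hahn_neg nu) = 0%E.
  move=> mA; apply/eqP; rewrite eq_le measure_ge0 andbT.
  by case: negN => _; apply => //; exact: measurableI.
have negE A : measurable A -> jordan_neg (hahnP nu) A = 0%E.
  move=> mA; rewrite jordan_negE cjordan_negE /crestr0 mem_set// /crestr /=.
  by rewrite /nu /charge_of_finite_measure muN0// oppe0.
have posE A : measurable A -> jordan_pos (hahnP nu) A = mu A.
  move=> mA; rewrite jordan_posE cjordan_posE /crestr0 mem_set// /crestr /=.
  rewrite -[in RHS](setIT A) -PN setIUr measureU//.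
  - by rewrite [X in _ = (_ + X)%E](muN0 A mA) adde0.
  - exact: measurableI.
  - exact: measurableI.
  - by rewrite setIACA PN0 setI0.
rewrite /Rintegral (@eq_measure_integral _ _ _ _ mu (jordan_pos (hahnP nu))); last first.
  by move=> A mA _; exact: posE.
rewrite (@eq_measure_integral _ _ _ _ mzero (jordan_neg (hahnP nu))); last first.
  by move=> A mA _; exact: negE.
by rewrite integral_measure_zero subr0.
Qed.

End ChargeIntegral.

Section StieltjesOnCircle.
Context (R : realType).

(** A point lies in ]x - d/2, x], whose measure is an increment of the
    continuous function G. *)
Lemma lebesgue_stieltjes_set1 (G : cumulative R R) (x : R) : continuous G ->
  lebesgue_stieltjes_measure G [set x] = 0%E.
Proof.
move=> cG; apply/eqP; rewrite eq_le measure_ge0 andbT.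
apply/lee_addgt0Pr => e e0; rewrite add0e.
have /cvgrPdist_lt /(_ _ e0) : G y @[y --> x] --> G x by exact: cG.
move=> /nbhs_ballP[d /= d0 dG].
pose y := x - d / 2.
have yx : y < x by rewrite /y ltrBlDr ltrDl divr_gt0.
have Gy : G x - G y <= e.
  apply: le_trans (ler_norm _) _; apply/ltW/dG => /=.
  by rewrite /ball /= /y opprB addrC subrK gtr0_norm ?divr_gt0//; lra.
apply: (@le_trans _ _ (lebesgue_stieltjes_measure G `]y, x]%classic)).
  apply: le_measure; rewrite ?inE//.
  by move=> _ ->; rewrite /= in_itv /= yx lexx.
rewrite /lebesgue_stieltjes_measure /measure_extension /= measurable_mu_extE /=; last first.
  exact: is_ocitv.
by rewrite wlength_itv_bnd ?(ltW yx)// lee_fin.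
Qed.

Lemma lebesgue_stieltjes_itvco (G : cumulative R R) (x y : R) : continuous G ->
  x <= y -> lebesgue_stieltjes_measure G `[x, y[%classic = (G y - G x)%:E.
Proof.
move=> cG; rewrite le_eqVlt => /predU1P[->|xy].
  by rewrite set_itvco0 measure0 subrr.
have oc : lebesgue_stieltjes_measure G `]x, y]%classic = (G y - G x)%:E.
  rewrite /lebesgue_stieltjes_measure /measure_extension /= measurable_mu_extE /=; last first.
    exact: is_ocitv.
  by rewrite wlength_itv_bnd ?(ltW xy).
have ccE : `[x, y]%classic = `[x, y[%classic `|` [set y].
  by rewrite (setUitv1 true)// bnd_simp ltW.
have ccE' : `[x, y]%classic = [set x] `|` `]x, y]%classic.
  by rewrite -(setU1itv false)// bnd_simp ltW.
have : lebesgue_stieltjes_measure G `[x, y]%classic = lebesgue_stieltjes_measure G `[x, y[%classic.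
  rewrite ccE measureU//.
  - rewrite -[X in (_ + X)%E]/(lebesgue_stieltjes_measure G [set y]).
    by rewrite lebesgue_stieltjes_set1// adde0.
  - by apply/seteqP; split => // z [/= + zy]; rewrite in_itv/= zy ltxx andbF.
move=> <-; rewrite ccE' measureU//.
- rewrite -[X in (X + _)%E]/(lebesgue_stieltjes_measure G [set x]).
  by rewrite lebesgue_stieltjes_set1// add0e.
- by apply/seteqP; split => // z [/= ->]; rewrite in_itv/= ltxx.
Qed.

Lemma circle_measurable : measurable (@circle R).
Proof. exact: measurable_itv. Qed.

(** Continuity of G lets the left-open intervals of the Stieltjes
    construction be exchanged for the left-closed arcs of [0, 2 pi[. *)
Lemma stieltjes_on_circle (G : R -> R) : {homo G : x y / x <= y} ->
  continuous G -> exists nu : {finite_measure set (measurableTypeR R) -> \bar R},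
    (forall A, measurable A -> A `&` @circle R = set0 -> nu A = 0%E) /\
    (forall x y, 0 <= x -> x <= y -> y <= 2 * pi ->
       nu `[x, y[%classic = (G y - G x)%:E).
Proof.
move=> ndG cG.
pose G' : cumulative R R := HB.pack G
  (@isCumulative.Build R _ R G ndG (right_continuousW cG)).
have p0 : 0 <= 2 * pi :> R by rewrite ltW// twopi_gt0.
have fin : (lebesgue_stieltjes_measure G' (@circle R) < +oo)%E.
  by rewrite /circle lebesgue_stieltjes_itvco// ltry.
exists (mfrestr circle_measurable fin); split.
  by move=> A mA A0; rewrite /= /mfrestr /mrestr A0 measure0.
move=> x y x0 xy y2; rewrite /= /mfrestr /mrestr setIidl.
  by rewrite lebesgue_stieltjes_itvco.
by apply: subset_itv; rewrite bnd_simp.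
Qed.

End StieltjesOnCircle.

(** * Riemann sums and weak convergence *)

Section CircleIntegral.
Context (R : realType).
Variable m : {measure set (measurableTypeR R) -> \bar R}.
Hypothesis m_fin : (m (@circle R) < +oo)%E.
Implicit Types (g h : R -> R).

Lemma integrable_continuous g : continuous g ->
  m.-integrable (@circle R) (EFin \o g).
Proof.
move=> cg; apply: measurable_bounded_integrable => //.
- exact: circle_measurable.
- exact: (measurable_funTS (continuous_measurable_fun cg)).
have cgw : {within `[0, 2 * pi], continuous g} by exact: continuous_subspaceT.
have /compact_bounded[M [_ Mg]] := continuous_compact cgw (@segment_compact R 0 (2 * pi)).
exists M; split; rewrite ?num_real// => x Mx t tc; apply: Mg => //.
exists t => //; exact: subset_itv_co_cc tc.
Qed.

Lemma integrable_arc g (x y : R) : continuous g -> 0 <= x -> y <= 2 * pi ->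
  m.-integrable `[x, y[ (EFin \o g).
Proof.
move=> cg x0 y2; apply: integrableS (integrable_continuous cg).
- exact: circle_measurable.
- exact: measurable_itv.
- by apply: subset_itv; rewrite bnd_simp.
Qed.

Lemma Rintegral_circle_split g (x : nat -> R) (K : nat) : continuous g ->
  x 0%N = 0 -> x K = 2 * pi -> {homo x : i j / (i <= j)%N >-> i <= j} ->
  \int[m]_(t in @circle R) g t = \sum_(i < K) \int[m]_(t in `[x i, x i.+1[) g t.
Proof.
move=> cg x0 xK xh; rewrite /circle -xK.
suff H k : (k <= K)%N -> \int[m]_(t in `[0, x k[) g t =
    \sum_(i < k) \int[m]_(t in `[x i, x i.+1[) g t by exact: H.
elim: k => [|i IH] iK; first by rewrite big_ord0 x0 set_itvco0 Rintegral_set0.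
have xi0 : 0 <= x i by rewrite -x0 xh.
rewrite big_ord_recr /= -IH ?(ltnW iK)//.
rewrite (@itv_bndbnd_setU _ _ _ (BLeft (x i))) ?bnd_simp ?xh//.
rewrite Rintegral_setU//.
- rewrite -itv_bndbnd_setU ?bnd_simp ?xh//.
  by apply: integrable_arc; rewrite // -xK xh.
- apply/disj_setPS => t [/=]; rewrite !in_itv /= => /andP[_ ti] /andP[].
  by rewrite leNgt ti.
Qed.

(** The weight h allows the same estimate to serve for a density against
    Lebesgue measure and, with h = 1, for a measure without density. *)
Lemma riemann_sum_error g h (x : nat -> R) (K : nat) (e : R) :
  continuous g -> continuous h -> (forall t, 0 <= h t) ->
  x 0%N = 0 -> x K = 2 * pi -> {homo x : i j / (i <= j)%N >-> i <= j} ->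
  (forall i t, (i < K)%N -> x i <= t < x i.+1 -> `|g t - g (x i)| <= e) ->
  `|\int[m]_(t in @circle R) (g t * h t)
     - \sum_(i < K) g (x i) * \int[m]_(t in `[x i, x i.+1[) h t|
  <= e * \int[m]_(t in @circle R) h t.
Proof.
move=> cg ch h0 x0 xK xh ge.
have cM g1 g2 : continuous g1 -> continuous g2 -> continuous (fun t : R => g1 t * g2 t).
  by move=> c1 c2 t; apply: continuousM; [exact: c1|exact: c2].
have cC c : continuous (fun _ : R => c : R) by move=> t; exact: cvg_cst.
have ia g' i : (i < K)%N -> continuous g' -> m.-integrable `[x i, x i.+1[ (EFin \o g').
  by move=> iK cg'; apply: integrable_arc; rewrite // -?x0 -?xK ?xh.
rewrite !(Rintegral_circle_split _ x0 xK xh)//; last exact: cM.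
rewrite -sumrB mulr_sumr; apply: le_trans (ler_norm_sum _ _ _) _.
apply: ler_sum => i _; have iK := ltn_ord i.
rewrite -!RintegralZl ?ia// -RintegralB//; [|exact: ia (cM _ _ _ _)..].
apply: le_trans (le_normr_Rintegral _ _) _ => //.
  have -> : (EFin \o (fun t => g t * h t - g (x i) * h t)) =
            (EFin \o (fun t => (g t - g (x i)) * h t)).
    by apply/funext => t /=; rewrite mulrBl.
  apply: ia => //; apply: cM => // t.
  by apply: continuousB; [exact: cg|exact: cC].
apply: le_Rintegral => //.
- apply: (ia (fun t => `|g t * h t - g (x i) * h t|)) => // t.
  by apply: cvg_norm; apply: cvgB; apply: cM.
- by apply: ia => //; exact: cM.
move=> t /= tx; rewrite -mulrBl normrM (ger0_norm (h0 t)) ler_wpM2r//.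
exact: ge.
Qed.

End CircleIntegral.

Section UniformContinuity.
Context (R : realType).

(** Heine's theorem, from the near-covering form of compactness with the
    filter of small positive d. *)
Lemma uniform_on_segment (g : R -> R) (a b e : R) : continuous g -> 0 < e ->
  exists2 d : R, 0 < d & forall x y, a <= x <= b -> `|x - y| < d ->
    `|g x - g y| <= e.
Proof.
move=> cg e0.
have /compact_near_coveringP/(_ _ (0 : R)^'+
    (fun d x => forall y, `|x - y| < d -> `|g x - g y| <= e)) := @segment_compact R a b.
case.
  move=> x _; have /cvgrPdist_lt/(_ (e / 2)) : g y @[y --> x] --> g x by exact: cg.
  rewrite divr_gt0// => /(_ isT) /nbhs_ballP[d /= d0 dg].
  exists (ball x (d / 2), [set u | u < d / 2]); first split => /=.
  - by apply: nbhsx_ballx; rewrite divr_gt0.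
  - by apply: nbhs_right_lt; rewrite divr_gt0.
  move=> [z u] /= [xz ud] y zy; rewrite (splitr e).
  rewrite -(subrKA (g x)); apply: le_trans (ler_normD _ _) _.
  apply: lerD; apply/ltW; last first.
    apply: dg; rewrite /ball /= -(subrKA z) (le_lt_trans (ler_normD _ _))//.
    by rewrite (splitr d) ltrD// (lt_trans zy).
  rewrite distrC; apply: dg; rewrite /ball /= (lt_trans xz)//.
  by rewrite ltr_pdivrMr// ltr_pMr// ltr1n.
move=> /= d /= d0 dP; exists (d / 2); first by rewrite divr_gt0.
move=> x y xab xy; apply: (dP (d / 2)) => //=.
- by rewrite sub0r normrN gtr0_norm ?divr_gt0// ltr_pdivrMr// ltr_pMr// ltr1n.
- by rewrite divr_gt0.
Qed.

(** Both integrals lie within e/3 of Riemann sums over the same subdivision,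
    and these involve the measures only through finitely many increments of
    P N and of G. *)
Lemma weak_limit_of_primitives (nu : {finite_measure set (measurableTypeR R) -> \bar R})
    (h P : nat -> R -> R) (G : R -> R) :
  (forall N, continuous (h N)) -> (forall N t, 0 <= h N t) ->
  (forall N t, is_derive t (1 : R) (P N) (h N t)) ->
  (forall N, P N (2 * pi) - P N 0 = 1) ->
  (forall x, P N x @[N --> \oo] --> G x) ->
  (forall x y, 0 <= x -> x <= y -> y <= 2 * pi ->
     nu `[x, y[%classic = (G y - G x)%:E) ->
  forall g : R -> R, continuous g ->
  \int[@lebesgue_measure R]_(t in @circle R) (g t * h N t) @[N --> \oo] -->
  \int[nu]_(t in @circle R) g t.
Proof.
move=> ch h0 dP P1 PG nuG g cg; apply/cvgrPdist_le => e e0.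
have p0 := @twopi_gt0 R.
have e3 : 0 < e / 3 by rewrite divr_gt0.
have [d d0 gd] := uniform_on_segment 0 (2 * pi) cg e3.
have [K Kd] : exists K : nat, 2 * pi / K.+1%:R < d.
  exists (Num.bound (2 * pi / d)); rewrite ltr_pdivrMr// -ltr_pdivrMl// mulrC.
  apply: lt_le_trans (archi_boundP _) _; first by rewrite divr_ge0// ltW.
  by rewrite ler_nat.
(* a regular subdivision, finer than the modulus of continuity of g at level
   e/3 *)
pose x (i : nat) : R := 2 * pi * i%:R / K.+1%:R.
have x0 : x 0%N = 0 by rewrite /x mulr0 mul0r.
have xK : x K.+1 = 2 * pi by rewrite /x mulfK.
have xh : {homo x : i j / (i <= j)%N >-> i <= j}.
  by move=> i j ij; rewrite /x ler_pM2r ?invr_gt0// ler_pM2l// ler_nat.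
have xg i t : (i < K.+1)%N -> x i <= t < x i.+1 -> `|g t - g (x i)| <= e / 3.
  move=> iK /andP[xt tx]; apply: gd.
    rewrite (le_trans _ xt) -?x0 ?xh//=.
    by rewrite (le_trans (ltW tx))// -xK xh.
  rewrite ger0_norm ?subr_ge0//; apply: le_lt_trans Kd.
  rewrite lerBlDl (le_trans (ltW tx))// /x -(addn1 i) natrD mulrDr mulr1 mulrDl.
  exact: lexx.
have lam_fin : (@lebesgue_measure R (@circle R) < +oo)%E.
  by rewrite /circle lebesgue_measure_itv /= lte_fin; case: ifP => _; rewrite ?ltry.
have nu_fin : (nu (@circle R) < +oo)%E.
  by rewrite -ge0_fin_numE ?fin_num_measure//; exact: circle_measurable.
have hI N u v : u <= v -> \int[@lebesgue_measure R]_(t in `[u, v[) h N t = P N v - P N u.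
  by move=> uv; exact: Rintegral_primitive.
have nuI u v : 0 <= u -> u <= v -> v <= 2 * pi -> \int[nu]_(t in `[u, v[) (1 : R) = G v - G u.
  by move=> u0 uv v2; rewrite Rintegral_cst// mul1r [X in fine X](nuG _ _ u0 uv v2).
pose S N := \sum_(i < K.+1) g (x i) * (P N (x i.+1) - P N (x i)).
pose S' := \sum_(i < K.+1) g (x i) * (G (x i.+1) - G (x i)).
have SS : S N @[N --> \oo] --> S'.
  apply: cvg_big => //; first exact: add_continuous.
  by move=> i _; apply: cvgM; [exact: cvg_cst|apply: cvgB; exact: PG].
have E1 N : `|\int[@lebesgue_measure R]_(t in @circle R) (g t * h N t) - S N| <= e / 3.
  have totI : \int[@lebesgue_measure R]_(t in @circle R) h N t = 1.
    by rewrite /circle hI ?(ltW p0)// P1.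
  have := riemann_sum_error lam_fin cg (ch N) (h0 N) x0 xK xh xg.
  rewrite totI mulr1; apply: le_trans; rewrite le_eqVlt; apply/orP; left.
  apply/eqP; congr (`|_ - _|).
  by apply: eq_bigr => i _; rewrite hI// xh.
have E2 : `|\int[nu]_(t in @circle R) g t - S'| <= e / 3.
  have c1 : continuous (fun _ : R => 1 : R) by move=> t; exact: cvg_cst.
  have totI : \int[nu]_(t in @circle R) (1 : R) = 1.
    rewrite nuI ?(ltW p0)//.
    have : P N (2 * pi) - P N 0 @[N --> \oo] --> G (2 * pi) - G 0 by apply: cvgB.
    under eq_fun do rewrite P1.
    by move/cvg_lim => <-//; rewrite lim_cst.
  have := riemann_sum_error nu_fin cg c1 (fun=> ler01) x0 xK xh xg.
  rewrite totI mulr1; apply: le_trans; rewrite le_eqVlt; apply/orP; left.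
  apply/eqP; congr (`|_ - _|).
    by apply: eq_Rintegral => t _; rewrite mulr1.
  apply: eq_bigr => i _; rewrite nuI ?xh//.
    by rewrite -x0 xh.
  by rewrite -xK xh.
move/cvgrPdist_le : SS => /(_ _ e3); apply: filterS => N SN.
have -> : e = e / 3 + e / 3 + e / 3 by lra.
move: (E1 N) E2 SN; move: (\int[nu]_(t in _) _) (\int[_]_(t in _) _) => A B E1N E2' SN.
have -> : A - B = (A - S') + (S' - S N) - (B - S N) by ring.
apply: le_trans (ler_normB _ _) _; apply: lerD => //.
by apply: le_trans (ler_normD _ _) _; exact: lerD.
Qed.

End UniformContinuity.

(** * Singularity from two orthogonal systems *)

Section Singularity.
Context (R : realType).

(** Orthogonality makes the integral of the squared sum grow like K instead
    of K^2. *)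
Lemma chebyshev_orthogonal (m : {measure set (measurableTypeR R) -> \bar R})
    (u : nat -> R -> R) (d : R) (K : nat) :
  (m (@circle R) < +oo)%E -> (forall k, continuous (u k)) ->
  (forall k t, `|u k t| <= 2) ->
  (forall j k, (j < k)%N -> \int[m]_(t in @circle R) (u j t * u k t) = 0) ->
  0 < d -> (0 < K)%N ->
  (m (@circle R `&` [set t | (d * K%:R <= `|\sum_(k < K) u k t|)%R])
    <= (4 * fine (m (@circle R)) / d ^+ 2 / K%:R)%:E)%E.
Proof.
move=> mfin cu u2 orth d0 K0.
pose S N t : R := \sum_(k < N) u k t.
have cM (g1 g2 : R -> R) : continuous g1 -> continuous g2 ->
    continuous (fun t => g1 t * g2 t).
  by move=> c1 c2 t; apply: continuousM; [exact: c1|exact: c2].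
have cS N : continuous (S N).
  elim: N => [|N IH] t.
    rewrite (_ : S 0%N = cst 0); first exact: cvg_cst.
    by apply/funext => v; rewrite /S big_ord0.
  rewrite (_ : S N.+1 = S N \+ u N); first by apply: continuousD; [exact: IH|exact: cu].
  by apply/funext => v; rewrite /S big_ord_recr.
have iC (g : R -> R) : continuous g -> m.-integrable (@circle R) (EFin \o g).
  exact: integrable_continuous.
have mC := @circle_measurable R.
have cross N k : (N <= k)%N -> \int[m]_(t in @circle R) (S N t * u k t) = 0.
  elim: N => [|N IH] Nk.
    rewrite (_ : (fun t => _) = (fun=> 0)) ?Rintegral_cst ?mul0r//.
    by apply/funext => t; rewrite /S big_ord0 mul0r.
  transitivity (\int[m]_(t in @circle R) (S N t * u k t + u N t * u k t)).
    by apply: eq_Rintegral => t _; rewrite /S big_ord_recr /= mulrDl.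
  rewrite RintegralD//; [|exact: (iC _ (cM _ _ _ _))..].
  by rewrite IH ?orth ?addr0// ltnW.
have sq N : \int[m]_(t in @circle R) (S N t * S N t) <= 4 * fine (m (@circle R)) * N%:R.
  elim: N => [|N IH].
    rewrite (_ : (fun t => _) = (fun=> 0)) ?Rintegral_cst ?mul0r ?mulr0//.
    by apply/funext => t; rewrite /S big_ord0 mul0r.
  have -> : \int[m]_(t in @circle R) (S N.+1 t * S N.+1 t) =
     \int[m]_(t in @circle R) (S N t * S N t) +
     (2 * \int[m]_(t in @circle R) (S N t * u N t) +
      \int[m]_(t in @circle R) (u N t * u N t)).
    have cSu : continuous (fun t : R => S N t * u N t) by apply: (cM _ _).
    have cuu : continuous (fun t : R => u N t * u N t) by apply: (cM _ _).
    have cSS : continuous (fun t : R => S N t * S N t) by apply: (cM _ _).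
    have c2 : continuous (fun t : R => 2 * (S N t * u N t)).
      by apply: (cM (fun=> 2)) => // t; exact: cvg_cst.
    have c3 : continuous (fun t : R => 2 * (S N t * u N t) + u N t * u N t).
      by move=> t; apply: cvgD; [exact: c2|exact: cuu].
    rewrite -(RintegralZl _ mC (iC _ cSu)) -(RintegralD mC (iC _ c2) (iC _ cuu)).
    rewrite -(RintegralD mC (iC _ cSS) (iC _ c3)).
    by apply: eq_Rintegral => t _; rewrite /S big_ord_recr /=; ring.
  rewrite cross// mulr0 add0r -[N.+1%:R]natr1 mulrDr mulr1; apply: lerD => //.
  rewrite -Rintegral_cst//; apply: le_Rintegral => //.
  - exact: (iC _ (cM _ _ _ _)).
  - by apply: (iC (fun=> 4)) => t; exact: cvg_cst.
  move=> t _; rewrite -expr2 -real_normK ?num_real//.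
  rewrite (_ : 4 = 2 ^+ 2) ?ler_pXn2r ?nnegrE//.
  by rewrite -natrX.
have Kpos : 0 < K%:R :> R by rewrite ltr0n.
have dK : 0 < (d * K%:R) ^+ 2 by rewrite exprn_gt0// mulr_gt0.
have intS := iC _ (cM _ _ (cS K) (cS K)).
have /= := @le_integral_comp_abse _ _ _ m _ mC (EFin \o (fun t => S K t * S K t))
  ((d * K%:R) ^+ 2) id (@measurable_id _ _ _) (fun r r0 => r0)
  (fun x y _ _ xy => xy) (measurable_int _ intS) dK.
rewrite (_ : (fun t => _) = (fun t => (S K t * S K t)%:E)); last first.
  by apply/funext => t /=; rewrite ger0_norm// -expr2 sqr_ge0.
rewrite (_ : (\int[m]_(t in @circle R) _)%E =
    (\int[m]_(t in @circle R) (S K t * S K t))%:E); last first.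
  by rewrite /Rintegral fineK//; exact: integrable_fin_num.
rewrite (_ : [set x | (((d * K%:R) ^+ 2)%:E <= `|S K x * S K x|%:E)%E] =
    [set t | d * K%:R <= `|\sum_(k < K) u k t|]); last first.
  apply/seteqP; split => t /=; rewrite lee_fin normrM -expr2 ler_pXn2r ?nnegrE//;
    by rewrite mulr_ge0// ltW.
rewrite -lee_pdivlMl// => /le_trans; apply; rewrite -EFinM lee_fin.
rewrite ler_pdivrMl//; apply: le_trans (sq K) _.
rewrite le_eqVlt; apply/orP; left; apply/eqP; field.
by rewrite !gt_eqF.
Qed.

(** Along the averages over the first 2^i functions the Chebyshev bounds are
    summable. The set where infinitely many of the averages of w are at
    least c0/2 in absolute value is null for Lebesgue measure by the Borel--
    Cantelli lemma. Outside the i-th of these events the averages of w + c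
    are at least c0/2, which is an event of small measure for nu. *)
Lemma separating_set (nu : {finite_measure set (measurableTypeR R) -> \bar R})
    (w : nat -> R -> R) (c : nat -> R) (c0 : R) :
  (forall k, continuous (w k)) -> (forall k t, `|w k t| <= 1) ->
  0 < c0 -> (forall k, c0 <= c k <= 1) ->
  (forall j k, (j < k)%N ->
     \int[@lebesgue_measure R]_(t in @circle R) (w j t * w k t) = 0) ->
  (forall j k, (j < k)%N ->
     \int[nu]_(t in @circle R) ((w j t + c j) * (w k t + c k)) = 0) ->
  exists A : set (measurableTypeR R),
    [/\ measurable A, A `<=` @circle R, @lebesgue_measure R A = 0%E &
        nu (@circle R `\` A) = 0%E].
Proof.
move=> cw w1 c00 cc orth_leb orth_nu.
have mC := @circle_measurable R.
have lam_fin : (@lebesgue_measure R (@circle R) < +oo)%E.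
  by rewrite /circle lebesgue_measure_itv /= lte_fin; case: ifP => _; rewrite ?ltry.
have nu_fin : (nu (@circle R) < +oo)%E.
  by rewrite -ge0_fin_numE ?fin_num_measure.
pose d := c0 / 2; have d0 : 0 < d by rewrite divr_gt0.
pose A i := @circle R `&` [set t | d * (2 ^ i)%:R <= `|\sum_(k < 2 ^ i) w k t|].
pose B i := @circle R `&` [set t | d * (2 ^ i)%:R <= `|\sum_(k < 2 ^ i) (w k t + c k)|].
have msum (v : nat -> R -> R) N : (forall k, continuous (v k)) ->
    measurable (@circle R `&` [set t | d * (2 ^ N)%:R <= `|\sum_(k < 2 ^ N) v k t|]).
  move=> cv.
  have cvN K : continuous (fun t => \sum_(k < K) v k t).
    elim: K => [|K IH] t.
      rewrite (_ : (fun t => _) = cst 0); first exact: cvg_cst.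
      by apply/funext => x; rewrite big_ord0.
    rewrite (_ : (fun t => _) = (fun t => \sum_(k < K) v k t) \+ v K).
      by apply: continuousD; [exact: IH|exact: cv].
    by apply/funext => x; rewrite big_ord_recr.
  have mf : measurable_fun (@circle R) (fun t => `|\sum_(k < 2 ^ N) v k t|).
    apply: measurable_funTS; apply: continuous_measurable_fun => t.
    by apply: cvg_norm; exact: cvN.
  rewrite (_ : [set t | _] = (fun t => `|\sum_(k < 2 ^ N) v k t|) @^-1` `[d * (2 ^ N)%:R, +oo[).
    by apply: mf => //; exact: measurable_itv.
  by apply/seteqP; split => t /=; rewrite in_itv /= andbT.
have mA i : measurable (A i) by exact: msum.
have cwc k : continuous (fun t => w k t + c k).
  by move=> t; apply: cvgD; [exact: cw|exact: cvg_cst].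
have mB i : measurable (B i) by exact: (msum (fun k t => w k t + c k)).
have pow0 i : (0 < 2 ^ i)%N by rewrite expn_gt0.
have leA i : (@lebesgue_measure R (A i) <=
    (4 * fine (@lebesgue_measure R (@circle R)) / d ^+ 2 / (2 ^ i)%:R)%:E)%E.
  apply: chebyshev_orthogonal => // k t; apply: le_trans (w1 k t) _.
  by rewrite ler1n.
have leB i : (nu (B i) <=
    (4 * fine (nu (@circle R)) / d ^+ 2 / (2 ^ i)%:R)%:E)%E.
  apply: (@chebyshev_orthogonal _ (fun k t => w k t + c k)) => // k t.
  apply: le_trans (ler_normD _ _) _; rewrite -[leRHS]/(1 + 1); apply: lerD => //.
  by have /andP[ck0 ck1] := cc k; rewrite ger0_norm// (le_trans _ ck0)// ltW.
have AB i : @circle R `\` A i `<=` B i.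
  move=> t [tc nA]; split => //=; rewrite leNgt; apply/negP => ltB.
  apply: nA; split => //=; rewrite leNgt; apply/negP => ltA.
  (* both averages small would force an average of c below c0 *)
  have sumc : c0 * (2 ^ i)%:R <= \sum_(k < 2 ^ i) c k.
    rewrite mulr_natr -[X in _ *+ X]card_ord -sumr_const; apply: ler_sum => k _.
    by case/andP: (cc k).
  move: ltB ltA; rewrite big_split /= !ltr_norml => /andP[_ l1] /andP[l2 _].
  by move: sumc l1 l2; rewrite /d; lra.
exists (lim_sup_set A); split.
- by apply: bigcapT_measurable => k; apply: bigcup_measurable => j _; exact: mA.
- by move=> t /(_ 0%N I)[j _ []].
- apply: lim_sup_set_cvg0 => //.
  set C := 4 * fine (@lebesgue_measure R (@circle R)) / d ^+ 2 in leA.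
  have C0 : 0 <= C by rewrite divr_ge0 ?sqr_ge0// mulr_ge0// fine_ge0.
  apply: (@le_lt_trans _ _ (\sum_(i <oo) ((C * 2) / (2 ^ i.+1)%:R)%:E)%E).
    apply: lee_nneseries => // i _; apply: le_trans (leA i) _.
    rewrite lee_fin expnS natrM invfM mulrA mulfK//.
  apply: le_lt_trans (epsilon_trick0 _ _) _; last exact: ltry.
  by rewrite mulr_ge0.
- set C := 4 * fine (nu (@circle R)) / d ^+ 2 in leB.
  have C0 : 0 <= C by rewrite divr_ge0 ?sqr_ge0// mulr_ge0// fine_ge0.
  rewrite /lim_sup_set setDE setC_bigcap setI_bigcupr.
  have mD n : measurable (@circle R `&` ~` \bigcup_(j >= n) A j).
    apply: measurableI => //; apply: measurableC.
    by apply: bigcup_measurable => j _; exact: mA.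
  apply/eqP; rewrite eq_le measure_ge0 andbT.
  apply: le_trans (measure_sigma_subadditive _ _ _ (@subset_refl _ _)) _ => //.
    exact: bigcupT_measurable.
  rewrite eseries0// => n _ _.
  apply/eqP; rewrite eq_le measure_ge0 andbT; apply/lee_addgt0Pr => e e0.
  rewrite add0e; have [i iC] : exists i, C / (2 ^ i)%:R <= e.
    (* 2^i exceeds C / e as soon as i does *)
    exists (Num.bound (C / e)); rewrite ler_pdivrMr ?ltr0n//.
    rewrite -ler_pdivrMl// mulrC; apply: ltW.
    apply: lt_le_trans (archi_boundP _) _; first by rewrite divr_ge0// ltW.
    by rewrite ler_nat ltnW// ltn_expl.
  apply: (@le_trans _ _ (nu (B (n + i)%N))).
    apply: le_measure; rewrite ?inE//.
    move=> t [tc nA]; apply: AB; split => // At; apply: nA.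
    by exists (n + i)%N => //=; rewrite leq_addr.
  apply: le_trans (leB _) _; rewrite lee_fin; apply: le_trans iC.
  rewrite ler_wpM2l// lef_pV2 ?posrE ?ltr0n// ler_nat leq_exp2l//.
  exact: leq_addl.
Qed.

End Singularity.

(** * Limits of densities whose primitives converge geometrically *)

Section LimitMeasure.
Context (R : realType).

(** Subtracting or adding twice the step 2^-n makes the sequence monotone,
    which gives the limit and the error bound at once. *)
Lemma cvg_of_geometric_steps (u : nat -> R) :
  (forall n, `|u n.+1 - u n| <= 2^-1 ^+ n) ->
  exists2 l, u @ \oo --> l & forall n, `|u n - l| <= 2 * 2^-1 ^+ n.
Proof.
move=> uS.
(* 2 * 2^-n is the sum of all the remaining steps *)
pose lo n := u n - 2 * 2^-1 ^+ n; pose hi n := u n + 2 * 2^-1 ^+ n.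
have p0 n : 0 < 2^-1 ^+ n :> R by rewrite exprn_gt0.
have loS : nondecreasing_seq lo.
  apply/nondecreasing_seqP => n; rewrite /lo exprS; move: (uS n) (p0 n).
  by rewrite ler_norml => /andP[]; move: (_ ^+ n) (u n) (u n.+1) => e x y; lra.
have hiS : nonincreasing_seq hi.
  apply/nonincreasing_seqP => n; rewrite /hi exprS; move: (uS n) (p0 n).
  by rewrite ler_norml => /andP[]; move: (_ ^+ n) (u n) (u n.+1) => e x y; lra.
have lohi n : lo n <= hi n.
  by rewrite /lo /hi; move: (p0 n); move: (_ ^+ n) => e; lra.
have lo_cvg : cvgn lo.
  apply: nondecreasing_is_cvgn => //; exists (hi 0%N) => _ [n _ <-].
  by apply: le_trans (lohi n) _; exact: hiS.
have hi_cvg : cvgn hi.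
  apply: nonincreasing_is_cvgn => //; exists (lo 0%N) => _ [n _ <-].
  by apply: le_trans _ (lohi n); exact: loS.
have e0 : (fun n => 2 * 2^-1 ^+ n : R) @ \oo --> (0 : R).
  rewrite -[X in _ --> X](mulr0 2); apply: cvgM; first exact: cvg_cst.
  by apply: cvg_expr; rewrite ger0_norm// invf_lt1// ltr1n.
have u_lo : u @ \oo --> limn lo.
  rewrite -[X in _ --> X]addr0 (_ : u = lo \+ (fun n => 2 * 2^-1 ^+ n)).
    exact: cvgD.
  by apply/funext => n; rewrite /lo /= subrK.
have u_hi : u @ \oo --> limn hi.
  rewrite -[X in _ --> X]subr0 (_ : u = hi \- (fun n => 2 * 2^-1 ^+ n)).
    exact: cvgB.
  by apply/funext => n; rewrite /hi /= addrK.
have lim_eq : limn hi = limn lo by apply: cvg_unique u_hi u_lo.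
exists (limn lo) => // n; rewrite ler_norml.
have := nondecreasing_cvgn_le loS lo_cvg n.
have := nonincreasing_cvgn_ge hiS hi_cvg n; rewrite lim_eq.
by rewrite /lo /hi; move: (limn _) (_ ^+ n) (u n) => l e x; lra.
Qed.

(** The geometric bound on the increments makes the convergence of the
    primitives uniform, so the limit is continuous and no mass can
    concentrate at a point. *)
Lemma limit_measure (h P : nat -> R -> R) :
  (forall N, continuous (h N)) -> (forall N t, 0 <= h N t) ->
  (forall N (t : R), is_derive t (1 : R) (P N) (h N t)) ->
  (forall N, P N (2 * pi) - P N 0 = 1) ->
  (forall N t, `|P N.+1 t - P N t| <= 2^-1 ^+ N) ->
  exists nu : {finite_measure set (measurableTypeR R) -> \bar R},
    [/\ forall A, measurable A -> A `&` @circle R = set0 -> nu A = 0%E,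
        nu (@circle R) = 1%E &
        forall g : R -> R, continuous g ->
          \int[@lebesgue_measure R]_(t in @circle R) (g t * h N t) @[N --> \oo] -->
          \int[nu]_(t in @circle R) g t].
Proof.
move=> ch h0 dP P1 PS.
have /boolp.choice[G PG] : forall t, exists l : R, P N t @[N --> \oo] --> l /\
    forall n, `|P n t - l| <= 2 * 2^-1 ^+ n.
  move=> t; have [l Pl lP] := cvg_of_geometric_steps (fun n => PS n t).
  by exists l.
have p0 := @twopi_gt0 R.
have ndP N : {homo P N : x y / x <= y}.
  move=> x y xy; rewrite -subr_ge0 -(Rintegral_primitive xy (dP N) (ch N)).
  by apply: Rintegral_ge0 => t _; exact: h0.
have ndG : {homo G : x y / x <= y}.
  move=> x y xy; apply: (ler_cvg_to (PG x).1 (PG y).1).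
  by apply: nearW => N; exact: ndP.
have cP N : continuous (P N).
  move=> x; apply: differentiable_continuous; apply/derivable1_diffP.
  by case: (dP N x).
have cG : continuous G.
  move=> x; apply/cvgrPdist_le => e e0.
  have [N NE] : exists N, 2 * 2^-1 ^+ N <= e / 3.
    have : (fun n => 2 * 2^-1 ^+ n : R) @ \oo --> (0 : R).
      rewrite -[X in _ --> X](mulr0 2); apply: cvgM; first exact: cvg_cst.
      by apply: cvg_expr; rewrite ger0_norm// invf_lt1// ltr1n.
    move=> /cvgrPdist_le/(_ (e / 3)); rewrite divr_gt0// => /(_ isT)[N _ HN].
    by exists N; have := HN N (leqnn N); rewrite sub0r normrN ger0_norm.
  have /cvgrPdist_le/(_ (e / 3)) : P N y @[y --> x] --> P N x by exact: cP.
  rewrite divr_gt0// => /(_ isT); apply: filterS => y Pxy.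
  have := le_trans ((PG x).2 N) NE; have := le_trans ((PG y).2 N) NE; move: Pxy.
  rewrite !ler_norml; move: (P N x) (P N y) (G x) (G y) => a b c d.
  by move=> /andP[? ?] /andP[? ?] /andP[? ?]; apply/andP; split; lra.
have [nu [nu0 nuG]] := stieltjes_on_circle ndG cG.
exists nu; split => //.
  rewrite /circle nuG ?(ltW p0)//; congr (_%:E).
  have : P N (2 * pi) - P N 0 @[N --> \oo] --> G (2 * pi) - G 0.
    by apply: cvgB; exact: (PG _).1.
  under eq_fun do rewrite P1.
  by move/cvg_lim => <-//; rewrite lim_cst.
apply: (weak_limit_of_primitives ch h0 dP P1 _ nuG).
by move=> t; exact: (PG t).1.
Qed.

End LimitMeasure.

(** * Positive measures as complex measures on the circle *)

Section PositiveCircleMeasure.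
Context (R : realType).
Variable nu : {finite_measure set (measurableTypeR R) -> \bar R}.
Hypothesis nu_carried : forall A, measurable A -> A `&` @circle R = set0 -> nu A = 0%E.

Lemma mzero_lty : (@mzero _ (measurableTypeR R) R setT < +oo)%E.
Proof. exact: ltry. Qed.

(** The imaginary part of a positive measure. Restricting to the whole space
    only serves to attach the structure of finite measure. *)
Definition zero_measure : {finite_measure set (measurableTypeR R) -> \bar R} :=
  mfrestr measurableT mzero_lty.

Definition positive_circle_measure : circle_measure R :=
  @CircleMeasure R (charge_of_finite_measure nu) (charge_of_finite_measure zero_measure)
    (fun A mA A0 => conj (nu_carried mA A0) erefl).

Local Notation mu := positive_circle_measure.

Lemma positive_cm_val A : cm_val mu A = (fine (nu A))%:C.
Proof. by []. Qed.

Lemma positive_cm_integral (f : R -> R[i]) : cm_integral mu f =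
  (\int[nu]_(t in @circle R) complex.Re (f t)) +i*
  (\int[nu]_(t in @circle R) complex.Im (f t)).
Proof.
have zero_int (g : R -> R) : \int[zero_measure]_(t in @circle R) g t = 0.
  by rewrite /Rintegral (@eq_measure_integral _ _ _ _ mzero)// integral_measure_zero.
by rewrite /cm_integral /= !charge_integral_finite_measure !zero_int subr0 addr0.
Qed.

Lemma positive_cm_positive : cm_positive mu.
Proof. by move=> A mA; rewrite positive_cm_val ler0c fine_ge0. Qed.

(** For a positive measure every partition gives the same sum, the total
    mass. *)
Lemma positive_cm_norm : nu (@circle R) = 1%E -> cm_norm mu = 1%E.
Proof.
move=> nu1; rewrite /cm_norm; set S := (X in ereal_sup X).
suff -> : S = [set 1%E] by rewrite ereal_sup1.
have finE (A : set (measurableTypeR R)) : measurable A ->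
    (complex.Re `|cm_val mu A|)%:E = nu A.
  move=> mA; rewrite positive_cm_val ger0_norm ?ler0c ?fine_ge0//=.
  by rewrite fineK// fin_num_measure.
have one E : (forall i, measurable (E i)) -> trivIset setT E ->
    \bigcup_i E i = @circle R ->
    (\sum_(0 <= i <oo) (complex.Re `|cm_val mu (E i)|)%:E)%E = 1%E.
  move=> mE tE UE; rewrite -nu1 -UE measure_semi_bigcup//.
    by apply: eq_eseriesr => i _; exact: finE.
  by rewrite UE; exact: circle_measurable.
apply/seteqP; split => [s [E [mE tE UE ->]]|_ ->] /=; first exact: one.
pose E (i : nat) : set (measurableTypeR R) := if i == 0%N then @circle R else set0.
have mE i : measurable (E i).
  by rewrite /E; case: ifP => _; [exact: circle_measurable|exact: measurable0].
have tE : trivIset setT E.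
  move=> i j _ _; rewrite /E; case: eqP => [->|_]; case: eqP => [->//|_];
    by rewrite ?setI0 ?set0I => -[x []].
have UE : \bigcup_i E i = @circle R.
  apply/seteqP; split => [t [i _]|t tc]; last by exists 0%N.
  by rewrite /E; case: ifP.
by exists E; split => //; rewrite one.
Qed.

Lemma positive_cm_singular (A : set (measurableTypeR R)) :
  measurable A -> A `<=` @circle R -> @lebesgue_measure R A = 0%E ->
  nu (@circle R `\` A) = 0%E -> cm_singular mu.
Proof.
move=> mA Ac lA nuA; exists A; split => // B mB BA.
have mC := @circle_measurable R.
rewrite positive_cm_val; suff -> : nu B = 0%E by [].
have mCA : measurable (@circle R `\` A) by exact: measurableD.
have mBC : measurable (B `\` @circle R) by exact: measurableD.
apply/eqP; rewrite eq_le measure_ge0 andbT.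
apply: (@le_trans _ _ (nu ((@circle R `\` A) `|` (B `\` @circle R)))).
  apply: le_measure; rewrite ?inE//; first exact: measurableU.
  move=> t Bt; have [tc|tc] := pselect (@circle R t); last by right.
  by left; split => // At; suff : (B `&` A) t by rewrite BA.
apply: le_trans (measureU2 _ _ _) _ => //.
rewrite [X in (X + _)%E]nuA add0e [leLHS]nu_carried//.
by apply/seteqP; split => // t [[_ nt]].
Qed.

End PositiveCircleMeasure.

(** * Convergence of complex sequences *)

Section ComplexLimits.
Context (R : realType).

Lemma normc_le_Re_Im (z : R[i]) :
  `|z| <= (`|complex.Re z| + `|complex.Im z|)%:C.
Proof.
rewrite [z in leLHS]complexE; apply: le_trans (ler_normD _ _) _.
have i1 : `|'i%C : R[i]| = 1 by rewrite normc_def /= expr0n add0r expr1n sqrtr1.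
have real_norm (x : R) : `|x%:C| = `|x|%:C :> R[i].
  by rewrite normc_def /= expr0n addr0 sqrtr_sqr.
by rewrite rmorphD /= normrM i1 mul1r !real_norm.
Qed.

Lemma normc_ge_Im (z : R[i]) : `|complex.Im z|%:C <= `|z|.
Proof.
rewrite normc_def lecR -sqrtr_sqr ler_wsqrtr// lerDr sqr_ge0//.
Qed.

Lemma cvg_complex (u : nat -> R[i]) (l : R[i]) :
  complex.Re (u N) @[N --> \oo] --> complex.Re l ->
  complex.Im (u N) @[N --> \oo] --> complex.Im l ->
  (fun N => u N : R[i]^o) @ \oo --> (l : R[i]^o).
Proof.
move=> cre cim; apply/cvgrPdist_le => e e0.
have [e1 eE] : exists e1 : R, e = e1%:C.
  by exists (complex.Re e); rewrite RRe_real// gtr0_real.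
have e10 : 0 < e1 / 2 by rewrite divr_gt0// -ltcR -eE.
move/cvgrPdist_le : cre => /(_ _ e10) cre; move/cvgrPdist_le : cim => /(_ _ e10) cim.
near=> N; apply: le_trans (normc_le_Re_Im _) _; rewrite eE lecR (splitr e1).
have ReB (x y : R[i]) : complex.Re (x - y) = complex.Re x - complex.Re y by case: x; case: y.
have ImB (x y : R[i]) : complex.Im (x - y) = complex.Im x - complex.Im y by case: x; case: y.
rewrite ReB ImB; apply: lerD.
  by near: N.
by near: N.
Unshelve. all: by end_near. Qed.

Lemma continuous_Re (g : R -> R[i]) : continuous (g : R -> R[i]^o) ->
  continuous (fun t => complex.Re (g t)).
Proof.
move=> cg t; apply/cvgrPdist_lt => e e0.
have /cvgrPdist_lt/(_ e%:C) := cg t; rewrite ltcR => /(_ e0); apply: filterS => x.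
move=> /(le_lt_trans (normc_ge_Re _)); rewrite ltcR.
by case: (g t); case: (g x).
Qed.

Lemma continuous_Im (g : R -> R[i]) : continuous (g : R -> R[i]^o) ->
  continuous (fun t => complex.Im (g t)).
Proof.
move=> cg t; apply/cvgrPdist_lt => e e0.
have /cvgrPdist_lt/(_ e%:C) := cg t; rewrite ltcR => /(_ e0); apply: filterS => x.
move=> /(le_lt_trans (normc_ge_Im _)); rewrite ltcR.
by case: (g t); case: (g x).
Qed.

End ComplexLimits.

(** * Frequencies and coefficients of Riesz products *)

Section RieszProduct.
Context (R : realType).
Variables (eps : nat -> R) (r m n : nat -> nat) (a : nat -> nat -> bool).
Hypothesis aE : forall (q : nat) (t : R),
  RS_P q t = \sum_(j <- iota 0 (2 ^ q)) (-1) ^+ a q j * cis (j%:R * t).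
Hypothesis eps_gt0 : forall k, 0 < eps k.
Hypothesis eps_lt1 : forall k, eps k < 1.
Hypothesis eps_decr : forall k, eps k.+1 < eps k.
Local Notation F := (freq_bound r m n).
Hypothesis r_gap : forall k, (2 * F k < r k)%N.
Hypothesis m_gap : forall k, (2 * F k < m k)%N.

Local Notation w := (riesz_w eps r m n).
Local Notation f := (riesz_partial eps r m n).

Definition riesz_deg (k : nat) : nat := ((2 ^ n k - 1) * m k + r k)%N.

Lemma freq_boundS k : F k.+1 = (F k + riesz_deg k)%N.
Proof. by rewrite /freq_bound big_ord_recr. Qed.

Lemma r_gt0 k : (0 < r k)%N. Proof. exact: leq_ltn_trans (r_gap k). Qed.
Lemma m_gt0 k : (0 < m k)%N. Proof. exact: leq_ltn_trans (m_gap k). Qed.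

Lemma freq_bound_ge k : (k <= F k)%N.
Proof.
elim: k => // k IH; rewrite freq_boundS /riesz_deg.
by have := r_gt0 k; move: (_ * _)%N IH => D; lia.
Qed.

Lemma freq_bound_homo j k : (j <= k)%N -> (F j <= F k)%N.
Proof.
move=> jk; rewrite -(subnKC jk); elim: (k - j)%N => [|i IH]; first by rewrite addn0.
by rewrite addnS freq_boundS (leq_trans IH)// leq_addr.
Qed.

Lemma riesz_deg_le j k : (j < k)%N -> (riesz_deg j <= F k)%N.
Proof.
by move=> jk; apply: leq_trans (freq_bound_homo jk); rewrite freq_boundS leq_addl.
Qed.

Definition riesz_freq (k j : nat) : int := (r k + j * m k)%N.

(** The terms of w_k, whose frequencies come in opposite pairs. *)
Definition riesz_terms (k : nat) : seq (R * int) :=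
  [seq ((-1) ^+ a (n k) j * eps k, riesz_freq k j) | j <- iota 0 (2 ^ n k)] ++
  [seq ((-1) ^+ a (n k) j * eps k, - riesz_freq k j) | j <- iota 0 (2 ^ n k)].

(** The terms of 1 - w_k. The frequency 0 of the constant 1 is as well
    separated from the others as these are from each other, which allows the
    three cases 0, + and - to be treated alike. *)
Definition factor_terms (k : nat) : seq (R * int) :=
  (1, 0) :: [seq (- x.1, x.2) | x <- riesz_terms k].

Fixpoint partial_terms (N : nat) : seq (R * int) :=
  if N is N'.+1 then expmul (partial_terms N') (factor_terms N') else [:: (1, 0)].

Lemma mem_riesz_terms k x : x \in riesz_terms k -> exists2 j, (j < 2 ^ n k)%N &
  x.1 = (-1) ^+ a (n k) j * eps k /\
  (x.2 = riesz_freq k j \/ x.2 = - riesz_freq k j).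
Proof.
rewrite mem_cat => /orP[] /mapP[j]; rewrite mem_iota add0n /= => jn ->;
  by exists j => //; split => //; solve [by left|by right].
Qed.

Lemma riesz_terms_opp k x : x \in riesz_terms k -> (x.1, - x.2) \in riesz_terms k.
Proof.
rewrite !mem_cat => /orP[] /mapP[j jn ->]; apply/orP; [right|left];
  by apply/mapP; exists j; rewrite /= ?opprK.
Qed.

Lemma size_riesz_terms k : size (riesz_terms k) = (2 ^ (n k).+1)%N.
Proof. by rewrite size_cat !size_map size_iota expnS mul2n addnn. Qed.

(** Two frequencies of the same sign differ by a multiple of m_k. *)
Lemma riesz_freq_sep k i j : i != j ->
  (2 * F k < `|riesz_freq k i - riesz_freq k j|)%N.
Proof.
move=> ij; apply: leq_trans (m_gap k) _; rewrite /riesz_freq.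
move: ij; rewrite neq_ltn => /orP[ij|ij].
  rewrite -(subnKC ij); move: (_ - _)%N => d; move: (m k) => M.
  by rewrite mulnDl mulSn; lia.
rewrite -(subnKC ij); move: (_ - _)%N => d; move: (m k) => M.
by rewrite mulnDl mulSn; lia.
Qed.

Lemma riesz_terms_ge k x : x \in riesz_terms k -> (r k <= `|x.2|)%N.
Proof. by case/mem_riesz_terms => j _ [_ [] ->]; rewrite /riesz_freq; lia. Qed.

Lemma riesz_terms_le k x : x \in riesz_terms k -> (`|x.2| <= riesz_deg k)%N.
Proof.
case/mem_riesz_terms => j jn [_ xE]; rewrite /riesz_deg.
have : (j * m k <= (2 ^ n k - 1) * m k)%N by rewrite leq_mul2r; lia.
by case: xE => ->; rewrite /riesz_freq; lia.
Qed.

Lemma riesz_terms_sep k x y : x \in riesz_terms k -> y \in riesz_terms k -> x.2 != y.2 ->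
  (2 * F k < `|x.2 - y.2|)%N.
Proof.
move=> /mem_riesz_terms[i _ [_ xE]] /mem_riesz_terms[j _ [_ yE]].
have rg := r_gap k; have [ij|/(riesz_freq_sep k)] := eqVneq i j.
  by rewrite -ij in yE; case: xE => ->; case: yE => ->; rewrite /riesz_freq; lia.
by case: xE => ->; case: yE => ->; rewrite /riesz_freq; lia.
Qed.

Lemma uniq_riesz_terms k : uniq (map snd (riesz_terms k)).
Proof.
have inj : injective (riesz_freq k).
  move=> i j; rewrite /riesz_freq => -[] /addnI /eqP.
  by rewrite eqn_pmul2r ?m_gt0// => /eqP.
rewrite map_cat cat_uniq -!map_comp; apply/and3P; split.
- by rewrite map_inj_uniq ?iota_uniq//; exact: inj.
- apply/hasPn => z /mapP[j _ ->]; apply/mapP => -[i _] /=.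
  by have := r_gt0 k; rewrite /riesz_freq; lia.
- by rewrite map_inj_uniq ?iota_uniq// => i j /oppr_inj; exact: inj.
Qed.

Lemma riesz_wE k t : w k t = expsum (riesz_terms k) t.
Proof.
rewrite /riesz_w expsum_cat aE /expsum !big_map rmorph_sum /= !mulr_sumr !mulr_suml.
congr (_ + _); apply: eq_bigr => j _ /=; rewrite rmorphM rmorphXn rmorphN rmorph1.
  rewrite -!mulrA mulrCA; congr (_ * _); congr (_ * _).
  by rewrite -cisD /riesz_freq mulrA -mulrDl -natrM -natrD addnC.
rewrite rmorphM rmorphXn rmorphN rmorph1 -!mulrA mulrCA.
congr (_ * _); congr (_ * _).
rewrite -[X in X * _]/((cis (j%:R * ((m k)%:R * t)))^*%C).
rewrite conj_cis -cisD /riesz_freq mulrA -natrM -opprD -mulrDl -natrD addnC.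
by rewrite mulrNz mulNr.
Qed.

Lemma one_sub_riesz_wE k t : 1 - w k t = expsum (factor_terms k) t.
Proof.
rewrite riesz_wE expsum_cons /= mul0r cis0 mulr1; congr (_ + _).
rewrite /expsum big_map -sumrN; apply: eq_bigr => x _.
by rewrite /= rmorphN mulNr.
Qed.

Lemma riesz_partialE N t : f N t = expsum (partial_terms N) t.
Proof.
elim: N => [|N IH].
  by rewrite /riesz_partial big_ord0 expsum_cons expsum_nil mul0r cis0 mulr1 addr0.
by rewrite /riesz_partial big_ord_recr /= expsum_mul -IH -one_sub_riesz_wE.
Qed.

Lemma mem_factor_terms k y : y \in factor_terms k ->
  y = (1, 0) \/ (- y.1, y.2) \in riesz_terms k.
Proof.
rewrite inE => /predU1P[->|/mapP[x xw ->]]; first by left.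
by right; rewrite /= opprK; case: x xw.
Qed.

Lemma factor_terms_le k y : y \in factor_terms k -> (`|y.2| <= riesz_deg k)%N.
Proof. by case/mem_factor_terms => [->//|/riesz_terms_le]. Qed.

(** Frequencies of opposite sign, and a frequency and 0, differ by at least
    r_k. *)
Lemma factor_terms_sep k x y : x \in factor_terms k -> y \in factor_terms k ->
  x.2 != y.2 -> (2 * F k < `|x.2 - y.2|)%N.
Proof.
move=> /mem_factor_terms[->|xw] /mem_factor_terms[->|yw] //=.
- by move=> _; rewrite sub0r abszN; apply: leq_trans (riesz_terms_ge yw); exact: r_gap.
- by move=> _; rewrite subr0; apply: leq_trans (riesz_terms_ge xw); exact: r_gap.
- exact: riesz_terms_sep xw yw.
Qed.

Lemma uniq_factor_terms k : uniq (map snd (factor_terms k)).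
Proof.
rewrite /factor_terms /= -map_comp (eq_map (_ : _ =1 snd))// uniq_riesz_terms andbT.
by apply/mapP => -[x /riesz_terms_ge + x0]; rewrite -x0; have := r_gt0 k; lia.
Qed.

Lemma partial_terms_le N x : x \in partial_terms N -> (`|x.2| <= F N)%N.
Proof.
elim: N x => [|N IH] x /=; first by rewrite inE => /eqP ->.
case/mem_expmul => u [v [/IH uF /factor_terms_le vD ->]] /=.
by rewrite freq_boundS; move: u.2 v.2 (F N) (riesz_deg N) uF vD => {IH} /=; lia.
Qed.

(** If x + y = x' + y' with y, y' frequencies of the last factor, then y -
    y' = x' - x is at most 2 F_N, so y = y' by separation. *)
Lemma uniq_partial_terms N : uniq (map snd (partial_terms N)).
Proof.
elim: N => [//|N IH] /=; rewrite /expmul map_allpairs /=.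
have -> : [seq x.2 + y.2 | x <- partial_terms N, y <- factor_terms N] =
   [seq x + y | x <- map snd (partial_terms N), y <- map snd (factor_terms N)].
  by rewrite allpairs_mapl allpairs_mapr.
apply: allpairs_uniq => //; first exact: uniq_factor_terms.
move=> p q /allpairsP[[x y] [/mapP[u uL xE] /mapP[v vL yE] pE]].
move=> /allpairsP[[x' y'] [/mapP[u' uL' xE'] /mapP[v' vL' yE'] qE]].
rewrite pE qE xE yE xE' yE' /= => e.
have vv : v.2 = v'.2.
  apply/eqP; apply: contraT => /(factor_terms_sep vL vL').
  move: (partial_terms_le uL) (partial_terms_le uL') e.
  by move: u.2 u'.2 v.2 v'.2 (F N) => ? ? ? ? ?; clear; lia.
by move: e; rewrite vv => /addIr ->.
Qed.

Definition signed_product (N : nat) (c : R) :=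
  exists (s : bool) (l : nat -> bool), c = (-1) ^+ s * \prod_(k < N) eps k ^+ l k.

Lemma partial_terms_coef N x : x \in partial_terms N -> signed_product N x.1.
Proof.
elim: N x => [|N IH] x /=.
  rewrite inE => /eqP ->; exists false, (fun=> false).
  by rewrite big_ord0 expr0 mulr1.
case/mem_expmul => u [v [/IH[s [l ul]] /mem_factor_terms vE ->]] /=.
have prodE b : \prod_(k < N.+1) eps k ^+ (if (k < N)%N then l k else b) =
    \prod_(k < N) eps k ^+ l k * eps N ^+ b.
  rewrite big_ord_recr /= ltnn; congr (_ * _).
  by apply: eq_bigr => i _; rewrite ltn_ord.
case: vE => [->|/mem_riesz_terms[j _ /= [vE _]]].
  exists s, (fun k => if (k < N)%N then l k else false).
  by rewrite prodE expr0 !mulr1.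
exists (s (+) ~~ a (n N) j), (fun k => if (k < N)%N then l k else true).
rewrite prodE expr1 ul -[v.1]opprK vE.
by rewrite signr_addb; case: (a (n N) j); rewrite /= ?expr1 ?expr0; ring.
Qed.

Lemma signed_product_le1 N c : signed_product N c -> `|c| <= 1.
Proof.
case=> s [l ->]; rewrite normrM normr_sign mul1r normr_prod.
elim: N => [|N IH]; first by rewrite big_ord0.
rewrite big_ord_recr /= mulr_ile1//.
  by apply: prodr_ge0.
by rewrite gtr0_norm ?exprn_gt0// exprn_ile1// ltW.
Qed.

Lemma eps_homo j k : (j <= k)%N -> eps k <= eps j.
Proof.
move=> jk; rewrite -(subnKC jk); elim: (k - j)%N => [|i IH]; first by rewrite addn0.
by rewrite addnS (le_trans _ IH)// ltW.
Qed.

(** A term whose last factor is the constant 1 is already a term of the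
    previous product. Any other term has a factor eps_k with k at least N0. *)
Lemma partial_terms_decay N0 N x : (N0 <= N)%N -> x \in partial_terms N ->
  (`|x.2| <= F N0)%N \/ `|x.1| <= eps N0.
Proof.
move=> /subnKC <-; elim: (N - N0)%N x => [|i IH] x.
  by rewrite addn0 => /partial_terms_le; left.
rewrite addnS /= => /mem_expmul[u [v [uL /mem_factor_terms[->|vw] ->]]] /=.
  by rewrite mulr1 addr0; exact: IH.
right; rewrite normrM -[leRHS]mul1r; apply: ler_pM => //.
  exact: signed_product_le1 (partial_terms_coef uL).
case/mem_riesz_terms: vw => j _ [/= + _]; rewrite -normrN => ->.
by rewrite normrM normr_sign mul1r gtr0_norm// eps_homo// leq_addr.
Qed.

(** * Positivity of the partial products *)

Hypothesis eps_hi : forall k, eps k ^+ 2 * 2 ^+ (n k + 3) < 1.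

Definition riesz_re (k : nat) (t : R) : R := complex.Re (w k t).

Definition riesz_density (N : nat) (t : R) : R := complex.Re (f N t).

Lemma riesz_w_addJ k t (z := (eps k)%:C * RS_P (n k) ((m k)%:R * t) * cis ((r k)%:R * t)) :
  w k t = z + conjc z.
Proof.
rewrite /riesz_w /z -conj_cis -[Num.conj _]/(conjc _); congr (_ + _).
by case: (RS_P _ _) => p q; case: (cis _) => u v; simpc; congr (_ +i* _); ring.
Qed.

Lemma riesz_wRe k t : w k t = (riesz_re k t)%:C.
Proof.
rewrite /riesz_re riesz_w_addJ; case: (_ * cis _) => u v.
by apply/eqP; rewrite eq_complex /= eqxx subrr eqxx.
Qed.

(** This is where the upper bound on eps_k 2^((n_k+3)/2) enters: |w_k| is at
    most 2 eps_k |P_(n_k)|, whose square is at most eps_k^2 2^(n_k+3). *)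
Lemma normr_riesz_re k t : `|riesz_re k t| < 1.
Proof.
rewrite -ltcR rmorph1 -[X in (`|X|)%:C]/(complex.Re (riesz_re k t)%:C) -riesz_wRe.
apply: le_lt_trans (normc_ge_Re _) _.
rewrite -(@ltr_pXn2r _ 2%N) ?nnegrE//= expr1n.
set z := (eps k)%:C * RS_P (n k) ((m k)%:R * t) * cis ((r k)%:R * t).
have zn : `|z| ^+ 2 <= (eps k ^+ 2 * 2 ^+ (n k).+1)%:C.
  rewrite /z !normrM !exprMn [X in _ * X](_ : _ = 1) ?mulr1; last first.
    by rewrite sqr_normc cisM_conj.
  rewrite rmorphM rmorphXn /= ler_pM ?exprn_ge0//.
    by rewrite ger0_norm ?lexx// ler0c ltW.
  by rewrite rmorphXn rmorph_nat RS_P_norm.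
have : `|w k t| ^+ 2 <= (2 * `|z|) ^+ 2.
  rewrite ler_pXn2r ?nnegrE// ?mulr_ge0// riesz_w_addJ -/z.
  by apply: le_trans (ler_normD _ _) _; rewrite normcJ mulr_natl mulr2n.
move=> /le_lt_trans; apply; rewrite exprMn.
apply: le_lt_trans (_ : 2 ^+ 2 * (eps k ^+ 2 * 2 ^+ (n k).+1)%:C < 1).
  by rewrite ler_pM2l// exprn_gt0.
rewrite -[X in X ^+ 2 * _](rmorph_nat (real_complex R)) -rmorphXn -rmorphM.
rewrite -(rmorph1 (real_complex R)).
by rewrite ltcR (le_lt_trans _ (eps_hi k))// mulrCA -exprD addnC addn2 -addn3.
Qed.

Lemma riesz_partialRe N t : f N t = (riesz_density N t)%:C.
Proof.
rewrite /riesz_density; suff [c ->] : exists c : R, f N t = c%:C by [].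
elim: N => [|N [c IH]].
  by exists 1; rewrite /riesz_partial big_ord0.
exists (c * (1 - riesz_re N t)); rewrite /riesz_partial big_ord_recr /=.
by rewrite -/(f N t) IH riesz_wRe rmorphM rmorphB rmorph1.
Qed.

Lemma riesz_densityS N t :
  riesz_density N.+1 t = riesz_density N t * (1 - riesz_re N t).
Proof.
apply: complexI; rewrite -riesz_partialRe /riesz_partial big_ord_recr /=.
by rewrite -/(f N t) riesz_partialRe riesz_wRe rmorphM rmorphB rmorph1.
Qed.

Lemma riesz_density_ge0 N t : 0 <= riesz_density N t.
Proof.
elim: N => [|N IH].
  by rewrite /riesz_density /riesz_partial big_ord0.
rewrite riesz_densityS mulr_ge0// subr_ge0.
by apply: ltW; apply: le_lt_trans (normr_riesz_re N t); exact: ler_norm.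
Qed.

(** * Means of products with the Riesz factors *)

Lemma spectrum_w_band k : spectrum_in (band (riesz_deg k)) (w k).
Proof.
by exists (riesz_terms k); [apply/allP => x; exact: riesz_terms_le|exact: riesz_wE].
Qed.

Lemma spectrum_w_out k :
  spectrum_in [pred q : int | (2 * F k < `|q|)%N] (w k).
Proof.
exists (riesz_terms k); last exact: riesz_wE.
by apply/allP => x /riesz_terms_ge; apply: leq_trans (r_gap k).
Qed.

Lemma spectrum_factor k : spectrum_in (gap (2 * F k)) (fun t => 1 - w k t).
Proof.
exists (factor_terms k); last exact: one_sub_riesz_wE.
apply/allP => x xf; rewrite /gap /=; case: eqP => //= /eqP x0.
have f0 : ((1 : R), (0 : int)) \in factor_terms k by rewrite mem_head.
by have := factor_terms_sep xf f0; rewrite subr0; apply.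
Qed.

Lemma spectrum_partial N : spectrum_in (band (F N)) (f N).
Proof.
exists (partial_terms N); last exact: riesz_partialE.
by apply/allP => x; exact: partial_terms_le.
Qed.

(** A frequency of w_k (1 - w_k) is x + y with - x and y frequencies of 1 -
    w_k, so separation applies to it. *)
Lemma spectrum_w_factor k :
  spectrum_in (gap (2 * F k)) (fun t => w k t * (1 - w k t)).
Proof.
exists (expmul (riesz_terms k) (factor_terms k)); last first.
  by move=> t; rewrite expsum_mul -riesz_wE -one_sub_riesz_wE.
apply/allP => z /mem_expmul[x [y [xw yf ->]]]; rewrite /gap /=.
have xf : (- x.1, - x.2) \in factor_terms k.
  by rewrite inE (map_f (fun z => (- z.1, z.2)) (riesz_terms_opp xw)) orbT.
case: eqP => //= /eqP xy0; have := factor_terms_sep xf yf.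
rewrite /= -opprD abszN; apply; apply: contra_neq xy0 => <-.
by rewrite subrr.
Qed.

Lemma haar_factor k : haar_integral (fun t => 1 - w k t) = 1.
Proof.
rewrite (haar_ext (one_sub_riesz_wE k)) haar_expsum.
have f0 : ((1 : R), (0 : int)) \in factor_terms k by rewrite mem_head.
by have /= -> := expcoef_uniq (uniq_factor_terms k) f0.
Qed.

(** The mean of w_k^2, computed in [haar_w_factor] by Parseval's identity. *)
Definition riesz_energy (k : nat) : R := 2 ^+ (n k).+1 * eps k ^+ 2.

(** Only the pairs of opposite frequencies contribute, each with the square
    of its coefficient. This is - M(w_k^2), because w_k has mean 0. *)
Lemma haar_w_factor k :
  haar_integral (fun t => w k t * (1 - w k t)) = (- riesz_energy k)%:C.
Proof.
rewrite (@haar_ext _ _ (expsum (expmul (riesz_terms k) (factor_terms k)))); last first.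
  by move=> t; rewrite expsum_mul -riesz_wE -one_sub_riesz_wE.
rewrite haar_expsum expcoef_mul; congr (_%:C).
transitivity (\sum_(x <- riesz_terms k) - eps k ^+ 2); last first.
  rewrite big_const_seq count_predT size_riesz_terms iter_addr_0 mulNrn; congr (- _).
  by rewrite /riesz_energy -[LHS]mulr_natl natrX.
apply: eq_big_seq => x xw; rewrite -mulr_sumr.
have xf : (- x.1, - x.2) \in factor_terms k.
  by rewrite inE (map_f (fun z => (- z.1, z.2)) (riesz_terms_opp xw)) orbT.
have /= := expcoef_uniq (uniq_factor_terms k) xf.
rewrite /expcoef => e; rewrite (eq_bigl (fun y => y.2 == - x.2)); last first.
  by move=> y; rewrite addrC addr_eq0.
rewrite e mulrN -expr2; case/mem_riesz_terms: xw => j _ [-> _].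
by rewrite exprMn sqrr_sign mul1r.
Qed.

(** Multiplying by a further factor 1 - w_N does not change the mean of g
    f_N, since g f_N has frequencies at most 2 F_N, while 1 - w_N has mean 1
    and all its other frequencies are larger. *)
Lemma haar_stable D g K N : spectrum_in (band D) g -> (D <= F K)%N -> (K <= N)%N ->
  haar_integral (fun t => g t * f N t) = haar_integral (fun t => g t * f K t).
Proof.
move=> gD DF /subnKC <-; elim: (N - K)%N => [|i IH]; first by rewrite addn0.
rewrite addnS -IH -[RHS]mulr1 -[X in _ = _ * X](haar_factor (K + i)).
rewrite -(@haarM _ (2 * F (K + i)))//; last exact: spectrum_factor.
  by apply: haar_ext => t; rewrite /riesz_partial big_ord_recr /= mulrA.
apply: spectrum_inS (spectrum_in_bandM gD (spectrum_partial (K + i))) => q.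
rewrite /band /= => /leq_trans; apply.
by rewrite mul2n -addnn leq_add2r (leq_trans DF)// freq_bound_homo// leq_addr.
Qed.

Lemma haar_partial N : haar_integral (f N) = 1.
Proof.
have s1 : spectrum_in (band 0) (fun _ : R => (1 : R[i])).
  by exists [:: (1, 0)] => // t; rewrite expsum_cons expsum_nil mul0r cis0 mulr1 addr0.
have /= := haar_stable s1 (leq0n (F 0)) (leq0n N).
rewrite (@haar_ext _ _ (f N)); last by move=> t; rewrite mul1r.
move=> ->; rewrite (@haar_ext _ _ (expsum [:: (1, 0)])); last first.
  by move=> t; rewrite mul1r riesz_partialE.
by rewrite haar_expsum /expcoef big_cons eqxx big_nil addr0.
Qed.

Lemma haar_w_partial k N : (k < N)%N ->
  haar_integral (fun t => w k t * f N t) = (- riesz_energy k)%:C.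
Proof.
move=> kN; rewrite (haar_stable (spectrum_w_band k) (riesz_deg_le (ltnSn k)) kN).
rewrite (@haar_ext _ _ (fun t => f k t * (w k t * (1 - w k t)))); last first.
  by move=> t; rewrite /riesz_partial big_ord_recr /= mulrCA mulrA.
rewrite (@haarM _ (2 * F k)); last exact: spectrum_w_factor.
  by rewrite haar_partial haar_w_factor mul1r.
apply: spectrum_inS (spectrum_partial k) => q; rewrite /band /= => /leq_trans; apply.
by rewrite mul2n -addnn leq_addr.
Qed.

(** Since w_k f_(k+1) = f_k w_k (1 - w_k), the factor depending on w_k
    splits off and leaves the mean of w_j f_k. *)
Lemma haar_ww_partial j k N : (j < k)%N -> (k < N)%N ->
  haar_integral (fun t => w j t * w k t * f N t) =
  (riesz_energy j * riesz_energy k)%:C.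
Proof.
move=> jk kN.
rewrite (haar_stable (spectrum_in_bandM (spectrum_w_band j) (spectrum_w_band k)) _ kN); last first.
  by rewrite freq_boundS leq_add2r riesz_deg_le.
rewrite (@haar_ext _ _ (fun t => (w j t * f k t) * (w k t * (1 - w k t)))); last first.
  by move=> t; rewrite /riesz_partial big_ord_recr /=; ring.
rewrite (@haarM _ (2 * F k)); last exact: spectrum_w_factor.
  by rewrite haar_w_partial// haar_w_factor -rmorphM mulrNN.
apply: spectrum_inS (spectrum_in_bandM (spectrum_w_band j) (spectrum_partial k)) => q.
rewrite /band /= => /leq_trans; apply.
by rewrite mul2n -addnn leq_add2r riesz_deg_le.
Qed.

Lemma haar_ww j k : (j < k)%N -> haar_integral (fun t => w j t * w k t) = 0.
Proof.
move=> jk; rewrite (@haarM _ (2 * F k)).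
- by rewrite (haar0 (spectrum_w_out k)) ?mulr0.
- apply: spectrum_inS (spectrum_w_band j) => q; rewrite /band /= => /leq_trans; apply.
  by rewrite (leq_trans (riesz_deg_le jk))// mul2n -addnn leq_addr.
- by apply: spectrum_inS (spectrum_w_out k) => q /= h; rewrite /gap /= h orbT.
Qed.

Lemma haar_cis_partial N q :
  haar_integral (fun t => cis (- (q%:~R * t)) * f N t) =
  (expcoef (partial_terms N) q)%:C.
Proof.
rewrite (@haar_ext _ _ (expsum (expmul [:: (1, - q)] (partial_terms N)))); last first.
  move=> t; rewrite expsum_mul riesz_partialE expsum_cons expsum_nil addr0.
  by rewrite mul1r mulrNz mulNr.
rewrite haar_expsum expcoef_mul big_seq1 /expcoef; congr (_%:C).
apply: eq_big => y; last by rewrite mul1r.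
by rewrite /= addrC subr_eq0.
Qed.

Lemma spectrum_cis q : spectrum_in (band `|q|) (fun t : R => cis (- (q%:~R * t))).
Proof.
exists [:: (1, - q)]; first by rewrite /= /band /= abszN leqnn.
by move=> t; rewrite expsum_cons expsum_nil addr0 mul1r mulrNz mulNr.
Qed.


(** * Primitives of the partial products *)

Hypothesis eps_lo : forall k, 4^-1 < eps k ^+ 2 * 2 ^+ (n k + 3).
Hypothesis r_large : forall k,
  (2 ^ k * (\prod_(j < k) (1 + 2 ^ (n j).+1) * 2 ^ (n k).+1) <= r k - F k)%N.

Lemma size_partial_terms N : size (partial_terms N) = (\prod_(j < N) (1 + 2 ^ (n j).+1))%N.
Proof.
elim: N => [|N IH]; first by rewrite big_ord0.
by rewrite big_ord_recr /= size_allpairs IH /= size_map size_riesz_terms.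
Qed.

(** The new terms have frequency at least r_N - F_N and coefficient at most
    1, and their number depends only on n_0, ..., n_N. *)
Lemma expprim_step N t :
  `|expprim (partial_terms N.+1) t - expprim (partial_terms N) t| <= 2^-1 ^+ N.
Proof.
(* the primitive of cos(q t), common to all terms of frequency q *)
pose S (q : int) : R := if q == 0 then t else sin (q%:~R * t) / q%:~R.
rewrite /expprim /= /expmul big_allpairs_dep /= -sumrB.
have -> : \sum_(x <- partial_terms N)
    (\sum_(y <- factor_terms N) x.1 * y.1 * S (x.2 + y.2) - x.1 * S x.2) =
    \sum_(x <- partial_terms N) \sum_(y <- riesz_terms N) - (x.1 * y.1) * S (x.2 + y.2).
  apply: eq_bigr => x _; rewrite big_cons /= mulr1 addr0 addrAC subrr add0r big_map.
  by apply: eq_bigr => y _; rewrite /= mulrN.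
have rF : (0 < r N - F N)%N by have := r_gap N; lia.
pose d : R := (r N - F N)%:R; have d0 : 0 < d by rewrite ltr0n.
have term x y : x \in partial_terms N -> y \in riesz_terms N ->
    `|- (x.1 * y.1) * S (x.2 + y.2)| <= d^-1.
  move=> xL yw; rewrite normrM normrN normrM.
  have x1 : `|x.1| <= 1 by exact: signed_product_le1 (partial_terms_coef xL).
  have y1 : `|y.1| <= 1.
    have [j _ [-> _]] := mem_riesz_terms yw.
    by rewrite normrM normr_sign mul1r gtr0_norm// ltW.
  have q_ge : (r N - F N <= `|(x.2 + y.2)%R|)%N.
    move: (partial_terms_le xL) (riesz_terms_ge yw).
    by move: x.2 y.2 (r N) (F N) => ? ? ? ?; clear; lia.
  have q0 : x.2 + y.2 != 0.
    by apply/eqP => q0; move: q_ge; rewrite q0 absz0 leqNgt rF.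
  rewrite -[leRHS]mul1r; apply: ler_pM => //; first exact: mulr_ile1.
  rewrite /S (negbTE q0) normrM normfV -[leRHS]mul1r; apply: ler_pM => //.
    by rewrite ler_norml sin_geN1 sin_le1.
  rewrite lef_pV2 ?posrE// ?normr_gt0 ?intr_eq0// -intr_norm -[`|_|%R]/(Posz `|_|%N).
  by rewrite /d -pmulrn ler_nat.
apply: le_trans (ler_norm_sum _ _ _) _.
apply: (@le_trans _ _ (\sum_(x <- partial_terms N) \sum_(y <- riesz_terms N) d^-1)).
  rewrite big_seq [leRHS]big_seq; apply: ler_sum => x xL.
  apply: le_trans (ler_norm_sum _ _ _) _.
  rewrite big_seq [leRHS]big_seq; apply: ler_sum => y yw; exact: term.
rewrite !big_const_seq !count_predT !iter_addr_0 size_riesz_terms size_partial_terms.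
rewrite -mulrnA -[leLHS]mulr_natl ler_pdivrMr// exprVn mulrC ler_pdivlMr ?exprn_gt0//.
rewrite -natrX -natrM ler_nat; apply: leq_trans (r_large N).
by rewrite mulnC [X in (_ * X)%N]mulnC.
Qed.

Hypothesis eps_cvg0 : eps @ \oo --> (0 : R).

(** * The limit measure *)

Let h (N : nat) (t : R) : R := riesz_density N t / (2 * pi).
Let P (N : nat) (t : R) : R := expprim (partial_terms N) t / (2 * pi).

Lemma riesz_densityE N t : riesz_density N t = complex.Re (expsum (partial_terms N) t).
Proof. by rewrite /riesz_density riesz_partialE. Qed.

Lemma continuous_riesz_density N : continuous (riesz_density N).
Proof.
rewrite (_ : riesz_density N = fun t => complex.Re (expsum (partial_terms N) t)).
  exact: continuous_Re_expsum.
by apply/funext => t; exact: riesz_densityE.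
Qed.

Lemma continuous_h N : continuous (h N).
Proof.
by move=> t; apply: cvgM; [exact: continuous_riesz_density|exact: cvg_cst].
Qed.

Lemma h_ge0 N t : 0 <= h N t.
Proof. by rewrite divr_ge0 ?riesz_density_ge0// ltW// twopi_gt0. Qed.

Lemma is_derive_P N (t : R) : is_derive t (1 : R) (P N) (h N t).
Proof.
rewrite /h riesz_densityE.
have := is_derive_expprim (partial_terms N) t => dE.
rewrite (_ : P N = (2 * pi)^-1 \*: expprim (partial_terms N)); last first.
  by apply/funext => v; rewrite /P mulrC.
by rewrite [X in is_derive _ _ _ X]mulrC; exact: is_deriveZ.
Qed.

Lemma lebesgue_circle_lty : (@lebesgue_measure R (@circle R) < +oo)%E.
Proof.
by rewrite /circle lebesgue_measure_itv /= lte_fin; case: ifP => _; rewrite ?ltry.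
Qed.

Lemma haar_mul_partial (g : R -> R[i]) N :
  continuous (fun t => complex.Re (g t)) -> continuous (fun t => complex.Im (g t)) ->
  haar_integral (fun t => g t * f N t) =
  (\int[@lebesgue_measure R]_(t in @circle R) (complex.Re (g t) * h N t)) +i*
  (\int[@lebesgue_measure R]_(t in @circle R) (complex.Im (g t) * h N t)).
Proof.
move=> cre cim; have mC := @circle_measurable R.
have scale (u : R -> R) : continuous u ->
    \int[@lebesgue_measure R]_(t in @circle R) (u t * h N t) =
    (2 * pi)^-1 * \int[@lebesgue_measure R]_(t in @circle R) (u t * riesz_density N t).
  move=> cu; rewrite -RintegralZl//.
    by apply: eq_Rintegral => t _; rewrite /h mulrA mulrC.
  apply: (integrable_continuous lebesgue_circle_lty) => t.
  by apply: cvgM; [exact: cu|exact: continuous_riesz_density].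
rewrite !scale// /haar_integral.
have -> : (fun t => complex.Re (g t * f N t)) =
    (fun t => complex.Re (g t) * riesz_density N t).
  apply/funext => t; rewrite riesz_partialRe.
  by case: (g t) => u v /=; rewrite mulr0 subr0.
have -> : (fun t => complex.Im (g t * f N t)) =
    (fun t => complex.Im (g t) * riesz_density N t).
  apply/funext => t; rewrite riesz_partialRe.
  by case: (g t) => u v /=; rewrite mulr0 add0r.
by apply/eqP; rewrite eq_complex /= !mul0r subr0 addr0 !eqxx.
Qed.

Lemma spectrum_continuous Q (g : R -> R[i]) : spectrum_in Q g ->
  continuous (fun t => complex.Re (g t)) /\ continuous (fun t => complex.Im (g t)).
Proof.
case=> s _ gs; rewrite (_ : g = expsum s); last exact/funext.
by split; [exact: continuous_Re_expsum|exact: continuous_Im_expsum].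
Qed.

Lemma P_total N : P N (2 * pi) - P N 0 = 1.
Proof.
rewrite -(Rintegral_primitive (ltW (@twopi_gt0 R)) (@is_derive_P N) (@continuous_h N)).
have c1 (c : R) : continuous (fun _ : R => c) by move=> t; exact: cvg_cst.
have := haar_partial N; rewrite (@haar_ext _ _ (fun t => 1 * f N t)); last first.
  by move=> t; rewrite mul1r.
rewrite haar_mul_partial; [|exact: c1|exact: c1] => -[e _].
by rewrite -[RHS]e; apply: eq_Rintegral => t _; rewrite mul1r.
Qed.

Lemma P_step N t : `|P N.+1 t - P N t| <= 2^-1 ^+ N.
Proof.
rewrite /P -mulrBl normrM -[leRHS]mulr1; apply: ler_pM => //; first exact: expprim_step.
rewrite normfV gtr0_norm ?twopi_gt0// invf_le1 ?twopi_gt0//.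
by have := pi_ge2 R; lra.
Qed.

(** Means against f_N are eventually constant for every exponential sum, so
    their limits, the integrals against mu, are known exactly. The values
    and the decay of the Fourier coefficients, and the orthogonality of the
    w_k + c_k, are read off from them. *)
Theorem riesz_product_measure : exists mu : circle_measure R,
  [/\ weak_star_limit f mu,
      [/\ cm_positive mu, M0 mu & cm_norm mu = 1%E],
      cm_singular mu
    & range (fourier mu) `<=` signed_products eps `|` [set 0]].
Proof.
have [nu [nu0 nu1 nu_lim]] := limit_measure continuous_h h_ge0 is_derive_P P_total P_step.
pose mu := positive_circle_measure nu0.
have nu_fin : (nu (@circle R) < +oo)%E by rewrite nu1 ltry.
have mC := @circle_measurable R.
have integral_eq Q (g : R -> R[i]) (c : R[i]) K : spectrum_in Q g ->
    (forall N, (K <= N)%N -> haar_integral (fun t => g t * f N t) = c) ->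
    cm_integral mu g = c.
  move=> /spectrum_continuous[cre cim] gK; rewrite positive_cm_integral.
  have lim_eq (u : R -> R) (b : R) : continuous u ->
      (forall N, (K <= N)%N -> \int[@lebesgue_measure R]_(t in @circle R) (u t * h N t) = b) ->
      \int[nu]_(t in @circle R) u t = b.
    move=> /nu_lim cu uK; apply: (cvg_unique _ cu) => //.
    by apply: cvg_near_cst; exists K => // N; exact: uK.
  apply/eqP; rewrite eq_complex /=; apply/andP; split; apply/eqP; apply: lim_eq => // N KN.
    by rewrite -(gK N KN) haar_mul_partial.
  by rewrite -(gK N KN) haar_mul_partial.
have fourierE q K : (`|q| <= K)%N -> fourier mu q = (expcoef (partial_terms K) q)%:C.
  move=> qK; apply: (integral_eq _ _ _ K (spectrum_cis q)) => N KN.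
  rewrite (haar_stable (spectrum_cis q) _ KN) ?haar_cis_partial//.
  exact: leq_trans qK (freq_bound_ge K).
have int_w k : \int[nu]_(t in @circle R) riesz_re k t = - riesz_energy k.
  have := integral_eq _ _ _ k.+1 (spectrum_w_band k) (@haar_w_partial k).
  by rewrite positive_cm_integral => -[].
have int_ww j k : (j < k)%N ->
    \int[nu]_(t in @circle R) (riesz_re j t * riesz_re k t) =
    riesz_energy j * riesz_energy k.
  move=> jk; have := integral_eq _ _ _ k.+1
    (spectrum_in_bandM (spectrum_w_band j) (spectrum_w_band k))
    (fun N => haar_ww_partial jk).
  rewrite positive_cm_integral => -[<- _]; apply: eq_Rintegral => t _.
  by rewrite !riesz_wRe /= mulr0 subr0.
have cw k : continuous (riesz_re k) by have [] := spectrum_continuous (spectrum_w_band k).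
exists mu; split.
- move=> g [cg _]; have cre := continuous_Re cg; have cim := continuous_Im cg.
  rewrite positive_cm_integral (_ : (fun N => _) = (fun N =>
    (\int[@lebesgue_measure R]_(t in @circle R) (complex.Re (g t) * h N t)) +i*
    (\int[@lebesgue_measure R]_(t in @circle R) (complex.Im (g t) * h N t)) : R[i]^o)).
    by apply: cvg_complex; exact: nu_lim.
  by apply/funext => N; exact: haar_mul_partial.
- split; [exact: positive_cm_positive| |exact: positive_cm_norm].
  move=> e e0; have /cvgrPdist_lt/(_ e e0)[N0 _ /(_ N0 (leqnn _))] := eps_cvg0.
  rewrite sub0r normrN gtr0_norm// => epse; exists (F N0).+1 => q qF.
  rewrite (fourierE q (maxn `|q| N0)) ?leq_maxl//.
  have [->|c0] := eqVneq (expcoef (partial_terms (maxn `|q| N0)) q) 0.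
    by rewrite normr0 ltcR.
  have [x xL [xq ->]] := expcoef_mem (uniq_partial_terms _) c0.
  rewrite normc_def /= expr0n addr0 sqrtr_sqr ltcR.
  case: (partial_terms_decay (leq_maxr _ _) xL) => [|/le_lt_trans]; last exact.
  by rewrite xq leqNgt qF.
- have energyE k : riesz_energy k = eps k ^+ 2 * 2 ^+ (n k + 3) / 4.
    by rewrite /riesz_energy -addSnnS exprD mulrC; field.
  have [||||||A [mA AC lA nuA]] := @separating_set R nu riesz_re riesz_energy (16^-1).
  + exact: cw.
  + by move=> k t; exact/ltW/normr_riesz_re.
  + by rewrite invr_gt0.
  + move=> k; rewrite energyE; move: (eps_lo k) (eps_hi k).
    by move: (_ * _) => y; lra.
  + move=> j k jk; have := haar_ww jk; rewrite /haar_integral => /eqP.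
    rewrite mulf_eq0 eq_complex /= invr_eq0 (gt_eqF (@twopi_gt0 R)) /=.
    case/eqP => + _; under eq_Rintegral do rewrite !riesz_wRe /= mulr0 subr0.
    by [].
  + move=> j k jk.
    have iN (u : R -> R) : continuous u -> nu.-integrable (@circle R) (EFin \o u).
      exact: integrable_continuous.
    have cc (c : R) : continuous (fun _ : R => c) by move=> t; exact: cvg_cst.
    have cZ (c : R) i : continuous (fun t => c * riesz_re i t).
      by move=> t; apply: cvgM; [exact: cc|exact: cw].
    have c2 : continuous (fun t => riesz_energy j * riesz_re k t +
        riesz_energy j * riesz_energy k).
      by move=> t; apply: cvgD; [exact: cZ|exact: cc].
    have c3 : continuous (fun t => riesz_energy k * riesz_re j t +
        (riesz_energy j * riesz_re k t + riesz_energy j * riesz_energy k)).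
      by move=> t; apply: cvgD; [exact: cZ|exact: c2].
    have cww : continuous (fun t => riesz_re j t * riesz_re k t).
      by move=> t; apply: cvgM; exact: cw.
    transitivity (\int[nu]_(t in @circle R) (riesz_re j t * riesz_re k t +
        (riesz_energy k * riesz_re j t +
        (riesz_energy j * riesz_re k t + riesz_energy j * riesz_energy k)))).
      by apply: eq_Rintegral => t _; ring.
    rewrite (RintegralD mC (iN _ cww) (iN _ c3)) (RintegralD mC (iN _ (cZ _ _)) (iN _ c2)).
    rewrite (RintegralD mC (iN _ (cZ _ _)) (iN _ (cc _))).
    rewrite !(RintegralZl _ mC (iN _ (cw _))) Rintegral_cst// !int_w int_ww//.
    rewrite [X in fine X]nu1 /=; ring.
  exact: (positive_cm_singular nu0 mA).
- move=> _ [q _ <-]; rewrite (fourierE q (`|q|).+1)//.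
  have [->|c0] := eqVneq (expcoef (partial_terms (`|q|).+1) q) 0; first by right.
  left; have [x xL [_ ->]] := expcoef_mem (uniq_partial_terms _) c0.
  have [s [l ->]] := partial_terms_coef xL; exists s, (`|q|).+1, l; split => //.
  by rewrite rmorphM rmorphXn rmorphN rmorph1.
Qed.

End RieszProduct.

(** * Choice of the degrees and frequencies *)

(** Take the last n before x^2 2^(n+3) reaches 1; the next value is twice as
    large. The bound x < 1/4 makes n = 1 admissible. The lower bound 1/2,
    rather than 1/4, makes the degrees of successive eps_k distinct. *)
Lemma exists_degree (R : realType) (x : R) : 0 < x -> x < 4^-1 ->
  exists n : nat, (0 < n)%N /\ 2^-1 <= x ^+ 2 * 2 ^+ (n + 3) < 1.
Proof.
move=> x0 x4; pose Q N := 1 <= x ^+ 2 * 2 ^+ (N + 3).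
have x20 : 0 < x ^+ 2 by rewrite exprn_gt0.
have exQ : exists N, Q N.
  exists (Num.bound (x ^+ 2)^-1); rewrite /Q -ler_pdivrMl// mulr1.
  apply: ltW; apply: lt_le_trans (archi_boundP _) _; first by rewrite invr_ge0 ltW.
  by rewrite -natrX ler_nat (leq_trans (ltnW (ltn_expl _ (ltnSn 1))))// leq_exp2l// leq_addr.
have [N QN minN] := ex_minnP exQ.
have x16 : x ^+ 2 * 2 ^+ (1 + 3) < 1.
  rewrite -natrX -[X in _ * X%:R]/16%N.
  have : x ^+ 2 < 4^-1 ^+ 2 by rewrite ltr_pXn2r ?nnegrE// ltW.
  by rewrite expr2 expr2; lra.
have N2 : (1 < N)%N.
  rewrite ltnNge; apply/negP => N1.
  have : Q 1%N.
    apply: le_trans QN _; rewrite ler_pM2l// ler_weXn2l ?ler1n//.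
    by rewrite leq_add2r.
  by rewrite /Q leNgt x16.
exists N.-1; split; first by rewrite -ltnS prednK// ltnW.
have NE : N = N.-1.+1 by rewrite prednK// ltnW.
apply/andP; split; last first.
  by rewrite ltNge; apply/negP => /minN; rewrite {1}NE ltnn.
move: QN; rewrite /Q {1}NE addSn [2 ^+ _.+1]exprS mulrCA.
by move: (_ ^+ 2 * _) => z; lra.
Qed.

Lemma sqr_powR_half (R : realType) (x : R) (n : nat) :
  (x * 2 `^ (n%:R / 2)) ^+ 2 = x ^+ 2 * 2 ^+ n.
Proof.
rewrite exprMn -[X in _ * X = _](@powR_mulrn _ _ 2)// ?powR_ge0// -powRrM.
by rewrite divfK// powR_mulrn.
Qed.

Local Close Scope complex_scope.

Theorem theorem32 (R : realType) (eps : nat -> R)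
    (eps_gt0 : forall k : nat, 0 < eps k)
    (eps_decr : forall k : nat, eps k.+1 < eps k)
    (eps_cvg0 : eps @ \oo --> (0 : R))
    (eps_half : forall k : nat, eps k.+1 < 2^-1 * eps k)
    (eps0_lt : eps 0%N < 4^-1) :
  exists r m n : nat -> nat,
    [/\ [/\ forall k, (0 < r k)%N, forall k, (0 < m k)%N
          & forall k, (0 < n k)%N],
        [/\ forall k, (r k < r k.+1)%N, forall k, (m k < m k.+1)%N
          & forall k, (n k < n k.+1)%N],
        forall k, (1 <= k)%N -> (2 * freq_bound r m n k < r k)%N,
        forall k, (1 <= k)%N -> (2 * freq_bound r m n k < m k)%N
      & forall k, 2^-1 < eps k * 2 `^ ((n k + 3)%:R / 2) < 1 ] /\
    exists mu : circle_measure R,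
      [/\ weak_star_limit (riesz_partial eps r m n) mu,
          [/\ cm_positive mu, M0 mu & cm_norm mu = 1%E],
          cm_singular mu
        & range (fourier mu) `<=` signed_products eps `|` [set 0]].
Proof.
have eps4 k : eps k < 4^-1.
  by elim: k => // k IH; exact: lt_trans (eps_decr k) IH.
have /boolp.choice[n nP] := fun k => exists_degree (eps_gt0 k) (eps4 k).
have n_gt0 k : (0 < n k)%N by have [] := nP k.
have n_lo k : 2^-1 <= eps k ^+ 2 * 2 ^+ (n k + 3) by have [_ /andP[]] := nP k.
have n_hi k : eps k ^+ 2 * 2 ^+ (n k + 3) < 1 by have [_ /andP[]] := nP k.
have n_incr k : (n k < n k.+1)%N.
  (* with n_(k+1) <= n_k the square for k + 1 would be below 1/4, but it is
     at least 1/2 *)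
  rewrite ltnNge; apply/negP => nk.
  have : eps k.+1 ^+ 2 * 2 ^+ (n k.+1 + 3) <= (2^-1 * eps k) ^+ 2 * 2 ^+ (n k + 3).
    apply: ler_pM; rewrite ?exprn_ge0//; first exact: ltW.
      rewrite ler_pXn2r ?nnegrE ?mulr_ge0//; exact: ltW.
    by rewrite ler_weXn2l ?ler1n// leq_add2r.
  have := n_lo k.+1; have := n_hi k.
  rewrite [(2^-1 * _) ^+ 2]exprMn -(mulrA (2^-1 ^+ 2)) [2^-1 ^+ 2]expr2.
  by move: (eps k ^+ 2 * _) (eps k.+1 ^+ 2 * _) => y z; lra.
(* B k is 2^k times a bound for the number of terms that the factor 1 - w_k
   adds, so that r_k - F_k >= B k gives the rate 2^-k for the primitives *)
pose B k := (2 ^ k * (\prod_(j < k) (1 + 2 ^ (n j).+1) * 2 ^ (n k).+1))%N.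
(* s k is the bound F_k and r k = m k = 2 s k + 1 + B k, so that the summand
   (2^(n_k) - 1) m_k + r_k of F_(k+1) only involves s k *)
pose s := fix s k := if k is k'.+1
  then (s k' + ((2 ^ n k' - 1) * (2 * s k' + 1 + B k') + (2 * s k' + 1 + B k')))%N
  else 0%N.
pose r k := (2 * s k + 1 + B k)%N.
have sE k : freq_bound r r n k = s k.
  elim: k => [|k IH]; first by rewrite /freq_bound big_ord0.
  by rewrite freq_boundS IH.
have r_gap k : (2 * freq_bound r r n k < r k)%N by rewrite sE /r; lia.
have r_incr k : (r k < r k.+1)%N.
  by rewrite {2}/r /= -/(r k); move: (_ * r k)%N (B k.+1) => p q; lia.
have eps_lt1 k : eps k < 1 by apply: lt_trans (eps4 k) _; rewrite invf_lt1// ltr1n.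
exists r, r, n; split; first split => //.
- by split=> // k; exact: leq_ltn_trans (r_gap k).
- move=> k; set y := _ * _ `^ _; have y0 : 0 < y by rewrite mulr_gt0// powR_gt0.
  have y2 : y ^+ 2 = eps k ^+ 2 * 2 ^+ (n k + 3) by exact: sqr_powR_half.
  apply/andP; split.
    rewrite -(@ltr_pXn2r _ 2%N) ?nnegrE ?(ltW y0)// y2.
    by apply: lt_le_trans (n_lo k); rewrite expr2; lra.
  by rewrite -(@ltr_pXn2r _ 2%N) ?nnegrE ?(ltW y0)// y2 expr1n.
have /boolp.choice[a aP] := fun q => rudin_shapiro_signs R q.
have aE q (t : R) : RS_P q t = \sum_(j <- iota 0 (2 ^ q)) (-1) ^+ a q j * cis (j%:R * t).
  by have [b bE] := aP q; rewrite /RS_P bE.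
apply: (riesz_product_measure aE) => // k.
- by apply: lt_le_trans (n_lo k); lra.
- by rewrite sE /r /B; lia.
Qed.
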